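(* (i) The timelike general rotational surface of first type $\mathcal{M}_1$ has flat normal connection if and only if, up to parametrization, the meridian curve is determined by $c: x(u)=(f(u),0,0,u)$, where $f(u)$ is a solution to the differential equation $$\left(\ln\left|\frac{1+f'}{1-f'}\right|\right)' = \frac{2(\alpha^2 f+\beta^2 u f')}{\alpha^2 f^2+\beta^2u^2}.$$ (ii) The timelike general rotational surface of second type $\mathcal{M}_2$ has flat normal connection if and only if, up to parametrization, the meridian curve is determined by $c: x(u)=(f(u),0,u,0)$, where $f(u)$ is a solution to the differential equation $$(\arctan f')' = \frac{\alpha^2 f+\beta^2 u f'}{\beta^2u^2-\alpha^2f^2}.$$
   Context: $\mathbb{R}^4_1$ is the four-dimensional Minkowski space, i.e. $\mathbb{R}^4$ with the flat metric $\langle\cdot,\cdot\rangle = dx_1^2+dx_2^2+dx_3^2-dx_4^2$. A surface in it is timelike if the induced metric has index 1. Let $J\subset\mathbb{R}$ be an interval, $f,g$ smooth functions on $J$, $\alpha,\beta$ positive constants, $u\in J$, $v\in[0,2\pi)$; a prime denotes $d/du$. Timelike general rotational surface of first type: $$\mathcal{M}_1: z(u,v)=(f(u)\cos\alpha v,\ f(u)\sin\alpha v,\ g(u)\sinh\beta v,\ g(u)\cosh\beta v),$$ where $f'^2-g'^2<0$ and $\alpha^2f^2+\beta^2g^2>0$. Its meridian curve is $c: x(u)=(f(u),0,0,g(u))$. Timelike general rotational surface of second type: $$\mathcal{M}_2: z(u,v)=(f(u)\cos\alpha v,\ f(u)\sin\alpha v,\ g(u)\cosh\beta v,\ g(u)\sinh\beta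 v),$$ where $\alpha^2f^2-\beta^2g^2<0$ and $f'^2+g'^2>0$. Its meridian curve is $c: x(u)=(f(u),0,g(u),0)$. Standing assumption: all surfaces are free of inflection points. This means that, for an orthonormal normal frame $\{n_1,n_2\}$ and $c_{11}^k=\langle z_{uu},n_k\rangle$, $c_{12}^k=\langle z_{uv},n_k\rangle$, $c_{22}^k=\langle z_{vv},n_k\rangle$ ($k=1,2$), the three determinants $\Delta_1=c_{11}^1c_{12}^2-c_{12}^1c_{11}^2$, $\Delta_2=c_{11}^1c_{22}^2-c_{22}^1c_{11}^2$, $\Delta_3=c_{12}^1c_{22}^2-c_{22}^1c_{12}^2$ do not all vanish at any point. The normal connection $D$ is defined by letting $D_x\xi$ be the normal component of $\widetilde\nabla_x\xi$ ($\widetilde\nabla$ the Levi-Civita connection of $\mathbb{R}^4_1$, $x$ tangent, $\xi$ normal). The curvature of the normal connection is $$\varkappa=\frac{\langle R^D(x,y,n_1),n_2\rangle}{\langle x,x\rangle\langle y,y\rangle-\langle x,y\rangle^2},\qquad R^D(x,y,n_1)=D_xD_yn_1-D_yD_xn_1-D_{[x,y]}n_1,$$ for a local tangent frame $\{x,y\}$ and an orthonormal normal frame $\{n_1,n_2\}$. A surface has flat normal connection if $\varkappa$ is zero.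
   Formalization: In (ii) the equivalence is stated for g' nowhere zero; a flat M_2 with a zero of g' is no graph (f(u),0,u,0). For every M_2: flat iff g' vanishes identically on no subinterval and every subinterval with g' nonzero has, up to parametrization, the stated form. *)

(* Defs.v *)
From Stdlib Require Import Reals List.
From Coquelicot Require Import Coquelicot.
Open Scope R_scope.

(** * Minkowski space and calculus conventions *)

Definition R4 : Type := (R * R * R * R)%type.

Definition x1 (p : R4) : R := fst (fst (fst p)).
Definition x2 (p : R4) : R := snd (fst (fst p)).
Definition x3 (p : R4) : R := snd (fst p).
Definition x4 (p : R4) : R := snd p.

Definition mink (p q : R4) : R :=
  x1 p * x1 q + x2 p * x2 q + x3 p * x3 q - x4 p * x4 q.

(** Intervals may be open, closed, half-open, bounded or not, but they are not
    reduced to a point. *)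
Definition is_interval (J : R -> Prop) : Prop :=
  (exists a b, J a /\ J b /\ a < b) /\
  (forall a b t, J a -> J b -> a <= t <= b -> J t).

(** Smoothness on [J] means smoothness in a neighbourhood of each point of
    [J]; this matters only at the endpoints which belong to [J]. *)
Definition smooth_on (J : R -> Prop) (f : R -> R) : Prop :=
  forall u, J u -> locally u (fun t => forall n, ex_derive_n f n t).

Definition du (f : R -> R -> R) : R -> R -> R :=
  fun u v => Derive (fun s => f s v) u.
Definition dv (f : R -> R -> R) : R -> R -> R :=
  fun u v => Derive (fun t => f u t) v.

Fixpoint iter_partial (w : list bool) (f : R -> R -> R) : R -> R -> R :=
  match w with
  | nil => f
  | cons true w' => du (iter_partial w' f)
  | cons false w' => dv (iter_partial w' f)
  end.

Definition smooth_near (f : R -> R -> R) (u v : R) : Prop :=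
  locally_2d (fun s t => forall w, differentiable_pt (iter_partial w f) s t) u v.

Definition du4 (z : R -> R -> R4) : R -> R -> R4 := fun u v =>
  (du (fun s t => x1 (z s t)) u v, du (fun s t => x2 (z s t)) u v,
   du (fun s t => x3 (z s t)) u v, du (fun s t => x4 (z s t)) u v).
Definition dv4 (z : R -> R -> R4) : R -> R -> R4 := fun u v =>
  (dv (fun s t => x1 (z s t)) u v, dv (fun s t => x2 (z s t)) u v,
   dv (fun s t => x3 (z s t)) u v, dv (fun s t => x4 (z s t)) u v).

Definition smooth4_near (xi : R -> R -> R4) (u v : R) : Prop :=
  smooth_near (fun s t => x1 (xi s t)) u v /\
  smooth_near (fun s t => x2 (xi s t)) u v /\
  smooth_near (fun s t => x3 (xi s t)) u v /\
  smooth_near (fun s t => x4 (xi s t)) u v.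

(** * Normal geometry of a parametrized surface [z] *)

(** Orthonormal normal frames of a timelike surface consist of spacelike unit
    vectors, the normal planes being positive definite. *)
Definition orthonormal_normal (z : R -> R -> R4) (u v : R) (n1 n2 : R4) : Prop :=
  mink n1 (du4 z u v) = 0 /\ mink n1 (dv4 z u v) = 0 /\
  mink n2 (du4 z u v) = 0 /\ mink n2 (dv4 z u v) = 0 /\
  mink n1 n1 = 1 /\ mink n2 n2 = 1 /\ mink n1 n2 = 0.

Definition inflection_free_at (z : R -> R -> R4) (u v : R) : Prop :=
  forall n1 n2 : R4, orthonormal_normal z u v n1 n2 ->
  let c11 n := mink (du4 (du4 z) u v) n in
  let c12 n := mink (dv4 (du4 z) u v) n in
  let c22 n := mink (dv4 (dv4 z) u v) n in
  let Delta1 := c11 n1 * c12 n2 - c12 n1 * c11 n2 in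
  let Delta2 := c11 n1 * c22 n2 - c22 n1 * c11 n2 in
  let Delta3 := c12 n1 * c22 n2 - c22 n1 * c12 n2 in
  ~ (Delta1 = 0 /\ Delta2 = 0 /\ Delta3 = 0).

(** The tangential part [a z_u + b z_v] of [w] is found by solving the Gram
    system obtained by pairing with [z_u] and [z_v]; the formula is the
    orthogonal projection wherever the induced metric is nondegenerate. *)
Definition normal_part (z : R -> R -> R4) (u v : R) (w : R4) : R4 :=
  let zu := du4 z u v in
  let zv := dv4 z u v in
  let E := mink zu zu in
  let F := mink zu zv in
  let G := mink zv zv in
  let a := (G * mink w zu - F * mink w zv) / (E * G - F ^ 2) in
  let b := (E * mink w zv - F * mink w zu) / (E * G - F ^ 2) in
  minus w (plus (scal a zu) (scal b zv)).

(** A tangent vector field is given by its components in the coordinate frame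
    [z_u, z_v]. *)
Definition tfield : Type := ((R -> R -> R) * (R -> R -> R))%type.

Definition push (z : R -> R -> R4) (X : tfield) : R -> R -> R4 := fun u v =>
  plus (scal (fst X u v) (du4 z u v)) (scal (snd X u v) (dv4 z u v)).

Definition lie_deriv (X : tfield) (f : R -> R -> R) : R -> R -> R := fun u v =>
  fst X u v * du f u v + snd X u v * dv f u v.

Definition bracket (X Y : tfield) : tfield :=
  (fun u v => lie_deriv X (fst Y) u v - lie_deriv Y (fst X) u v,
   fun u v => lie_deriv X (snd Y) u v - lie_deriv Y (snd X) u v).

(** The ambient Levi-Civita connection of the flat metric, along the surface. *)
Definition ambient_conn (X : tfield) (xi : R -> R -> R4) : R -> R -> R4 :=
  fun u v => plus (scal (fst X u v) (du4 xi u v)) (scal (snd X u v) (dv4 xi u v)).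

Definition normal_conn (z : R -> R -> R4) (X : tfield) (xi : R -> R -> R4) :
  R -> R -> R4 :=
  fun u v => normal_part z u v (ambient_conn X xi u v).

Definition normal_curv (z : R -> R -> R4) (X Y : tfield) (xi : R -> R -> R4) :
  R -> R -> R4 := fun u v =>
  minus (minus (normal_conn z X (normal_conn z Y xi) u v)
               (normal_conn z Y (normal_conn z X xi) u v))
        (normal_conn z (bracket X Y) xi u v).

Definition varkappa (z : R -> R -> R4) (X Y : tfield) (n1 n2 : R -> R -> R4)
  (u v : R) : R :=
  let x := push z X u v in
  let y := push z Y u v in
  mink (normal_curv z X Y n1 u v) (n2 u v) /
  (mink x x * mink y y - mink x y ^ 2).

Definition tangent_frame_near (X Y : tfield) (u v : R) : Prop :=
  smooth_near (fst X) u v /\ smooth_near (snd X) u v /\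
  smooth_near (fst Y) u v /\ smooth_near (snd Y) u v /\
  locally_2d (fun s t => fst X s t * snd Y s t - snd X s t * fst Y s t <> 0) u v.

Definition normal_frame_near (z : R -> R -> R4) (n1 n2 : R -> R -> R4)
  (u v : R) : Prop :=
  smooth4_near n1 u v /\ smooth4_near n2 u v /\
  locally_2d (fun s t => orthonormal_normal z s t (n1 s t) (n2 s t)) u v.

Definition flat_normal_connection_at (z : R -> R -> R4) (u v : R) : Prop :=
  forall (X Y : tfield) (n1 n2 : R -> R -> R4),
  tangent_frame_near X Y u v -> normal_frame_near z n1 n2 u v ->
  varkappa z X Y n1 n2 u v = 0.

Definition inflection_free (J : R -> Prop) (z : R -> R -> R4) : Prop :=
  forall u v, J u -> 0 <= v < 2 * PI -> inflection_free_at z u v.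

Definition flat_normal_connection (J : R -> Prop) (z : R -> R -> R4) : Prop :=
  forall u v, J u -> 0 <= v < 2 * PI -> flat_normal_connection_at z u v.

(** * General rotational surfaces *)

Definition surface1 (alpha beta : R) (f g : R -> R) : R -> R -> R4 := fun u v =>
  (f u * cos (alpha * v), f u * sin (alpha * v),
   g u * sinh (beta * v), g u * cosh (beta * v)).

Definition surface2 (alpha beta : R) (f g : R -> R) : R -> R -> R4 := fun u v =>
  (f u * cos (alpha * v), f u * sin (alpha * v),
   g u * cosh (beta * v), g u * sinh (beta * v)).

Definition timelike1 (alpha beta : R) (J : R -> Prop) (f g : R -> R) : Prop :=
  forall u, J u ->
    Derive f u ^ 2 - Derive g u ^ 2 < 0 /\
    alpha ^ 2 * f u ^ 2 + beta ^ 2 * g u ^ 2 > 0.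

Definition timelike2 (alpha beta : R) (J : R -> Prop) (f g : R -> R) : Prop :=
  forall u, J u ->
    alpha ^ 2 * f u ^ 2 - beta ^ 2 * g u ^ 2 < 0 /\
    Derive f u ^ 2 + Derive g u ^ 2 > 0.

Definition meridian1 (f g : R -> R) : R -> R4 := fun u => (f u, 0, 0, g u).
Definition meridian2 (f g : R -> R) : R -> R4 := fun u => (f u, 0, g u, 0).

(** The curve [c] on [J] and the curve [d] on [I] agree up to parametrization:
    [psi] is a diffeomorphism from [J] onto [I]. *)
Definition reparam (J : R -> Prop) (c : R -> R4) (I : R -> Prop) (d : R -> R4) :
  Prop :=
  exists psi : R -> R,
    smooth_on J psi /\
    (forall u, J u -> Derive psi u <> 0) /\
    (forall s, I s <-> exists u, J u /\ psi u = s) /\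
    (forall u, J u -> c u = d (psi u)).

Definition ode1 (alpha beta : R) (I : R -> Prop) (h : R -> R) : Prop :=
  forall u, I u ->
    is_derive (fun s => ln (Rabs ((1 + Derive h s) / (1 - Derive h s)))) u
      (2 * (alpha ^ 2 * h u + beta ^ 2 * u * Derive h u) /
       (alpha ^ 2 * h u ^ 2 + beta ^ 2 * u ^ 2)).

Definition ode2 (alpha beta : R) (I : R -> Prop) (h : R -> R) : Prop :=
  forall u, I u ->
    is_derive (fun s => atan (Derive h s)) u
      ((alpha ^ 2 * h u + beta ^ 2 * u * Derive h u) /
       (beta ^ 2 * u ^ 2 - alpha ^ 2 * h u ^ 2)).

Definition determined1 (alpha beta : R) (J : R -> Prop) (f g : R -> R) : Prop :=
  exists (I : R -> Prop) (h : R -> R),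
    is_interval I /\ smooth_on I h /\
    reparam J (meridian1 f g) I (meridian1 h (fun u => u)) /\
    ode1 alpha beta I h.

Definition determined2 (alpha beta : R) (J : R -> Prop) (f g : R -> R) : Prop :=
  exists (I : R -> Prop) (h : R -> R),
    is_interval I /\ smooth_on I h /\
    reparam J (meridian2 f g) I (meridian2 h (fun u => u)) /\
    ode2 alpha beta I h.

(** On a surface of second type [g'] may vanish at some points, even if the
    normal connection is flat, and then the meridian is not regularly
    reparametrizable as [(h(u), 0, u, 0)] there. Here the description is
    required on every piece of the meridian on which [g'] has no zero, together
    with the absence of pieces on which [g'] is identically zero. *)
Definition piecewise_determined2 (alpha beta : R) (J : R -> Prop) (f g : R -> R) :
  Prop :=
  forall K : R -> Prop, is_interval K -> (forall u, K u -> J u) ->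
    (exists u, K u /\ Derive g u <> 0) /\
    ((forall u, K u -> Derive g u <> 0) -> determined2 alpha beta K f g).

(* Main.v *)
Require Import Defs.
From Stdlib Require Import Reals Ranalysis5 Lra Lia List FunctionalExtensionality ClassicalEpsilon.
From Coquelicot Require Import Coquelicot.
Open Scope R_scope.

(** Why the theorem holds.  Both surfaces are orbits of the meridian under a
    one-parameter group which rotates one coordinate plane and boosts the other,
    so they can be handled together: the pair [(sinh, cosh)] (first type) or
    [(cosh, sinh)] (second type) is a pair [(sh, ch)] with [sh' = ch], [ch' = sh]
    and [ch ^ 2 - sh ^ 2 = eps], where [eps = 1], resp. [eps = -1].

    By the Ricci equation ([ricci_equation]) the normal curvature measures the
    failure of the two shape operators to commute.  The coordinate frame is
    orthogonal, with [E = f' ^ 2 - eps * g' ^ 2] and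
    [G = alpha ^ 2 * f ^ 2 + eps * beta ^ 2 * g ^ 2].  In the normal frame made
    of the normal [n1] of the meridian in the plane of radial directions and of
    a vector [n2] tangent to the product of the two orbits, the shape operator
    of [n1] is diagonal and that of [n2] is antidiagonal, the latter with entries
    proportional to [g * f' - f * g'].  The absence of inflection points makes this factor
    nonzero, so the operators commute exactly when that of [n1] is a multiple
    of the identity, that is, when
    [G * (f'' * g' - g'' * f') + E * (alpha ^ 2 * f * g' + beta ^ 2 * g * f') = 0].
    The left side is [meridian_defect], and this equivalence is
    [flat_iff_meridian_defect].

    If [f = h o g], the chain rule turns the defect of [(f, g)] into [g' ^ 3]
    times that of [(h, id)] ([meridian_defect_reparam]), and the vanishing of
    the latter is the differential equation of the theorem.  Where [g' <> 0]
    such an [h] exists by the inverse function theorem ([graph_over_image]); it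
    has to be smooth in a neighbourhood of every point of the image of the
    interval, endpoints included.  On a surface of first type [g' <> 0] follows
    from [f' ^ 2 < g' ^ 2].  On a surface of second type, vanishing of [g'] on
    a whole piece contradicts the vanishing of the defect, which there equals
    [beta ^ 2 * g * f' ^ 3]; conversely, if no such piece exists, the equation
    extends by continuity to the zeros of [g']. *)

(** * Smooth functions of one variable *)

(** The pointwise form of [smooth_on]; being smooth at a point is an open
    condition, which spares the choice of neighbourhoods. *)
Definition smooth_at (f : R -> R) (u : R) : Prop :=
  locally u (fun t => forall n, ex_derive_n f n t).

Lemma smooth_at_locally f u : smooth_at f u -> locally u (smooth_at f).
Proof. exact (locally_locally u _). Qed.

Lemma smooth_at_ext_loc f g u :
  locally u (fun t => f t = g t) -> smooth_at f u -> smooth_at g u.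
Proof.
  intros Hfg Hf.
  generalize (filter_and (F := locally u) _ _ (locally_locally u _ Hfg) Hf).
  unfold smooth_at. apply filter_imp. intros t [H1 H2] n.
  exact (ex_derive_n_ext_loc f g n t H1 (H2 n)).
Qed.

Lemma smooth_at_ex_derive f u : smooth_at f u -> ex_derive f u.
Proof. intros H. exact (locally_singleton _ _ H 1%nat). Qed.

Lemma smooth_at_continuous f u : smooth_at f u -> continuous f u.
Proof. intros H. exact (ex_derive_continuous f u (smooth_at_ex_derive f u H)). Qed.

Lemma smooth_at_Derive f u : smooth_at f u -> smooth_at (Derive f) u.
Proof.
  unfold smooth_at. apply filter_imp. intros t H [|n]; [exact I|]. simpl.
  apply (ex_derive_ext (Derive_n f (n + 1))).
  { intros s. symmetry. exact (Derive_n_comp f n 1 s). }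
  rewrite Nat.add_1_r. exact (H (S (S n))).
Qed.

Lemma smooth_at_Derive_n f n u : smooth_at f u -> smooth_at (Derive_n f n) u.
Proof. intros H. induction n as [|n IH]; [exact H|exact (smooth_at_Derive _ _ IH)]. Qed.

(** The functions on [U] obtained from a family [B] by sums, products and
    composition with smooth functions from the left.  If [B] is differentiated
    into this class then so is the class, and all its members are smooth; this
    one induction yields smoothness of sums, products, composites, and of
    solutions of differential equations such as [1 / t], [sqrt], [cos] and inverse
    functions. *)
Inductive differential_closure (B : (R -> R) -> Prop) (U : R -> Prop) : (R -> R) -> Prop :=
| closure_base f : B f -> differential_closure B U f
| closure_smooth f : smooth_on U f -> differential_closure B U f
| closure_plus f g : differential_closure B U f -> differential_closure B U g ->
    differential_closure B U (fun t => f t + g t)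
| closure_mult f g : differential_closure B U f -> differential_closure B U g ->
    differential_closure B U (fun t => f t * g t)
| closure_comp V phi f : smooth_on V phi -> differential_closure B U f ->
    (forall t, U t -> V (f t)) -> differential_closure B U (fun t => phi (f t)).

(** The open set [U] is fixed once for all orders of differentiation: an
    argument with germs would lose a neighbourhood at each order. *)
Lemma differential_closure_smooth (B : (R -> R) -> Prop) (U : R -> Prop) :
  open U ->
  (forall f, B f -> exists f', differential_closure B U f' /\
     forall t, U t -> is_derive f t (f' t)) ->
  forall f, differential_closure B U f -> smooth_on U f.
Proof.
  intros HU HB.
  assert (Hder : forall f, differential_closure B U f ->
    exists f', differential_closure B U f' /\ forall t, U t -> is_derive f t (f' t)).
  { intros f Hf.
    induction Hf
      as [f Hf|f Hf|f g Hf IHf Hg IHg|f g Hf IHf Hg IHg|V phi f HV Hf IHf HUV].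
    - exact (HB f Hf).
    - exists (Derive f). split.
      + apply closure_smooth. intros t Ht. exact (smooth_at_Derive f t (Hf t Ht)).
      + intros t Ht. apply Derive_correct, smooth_at_ex_derive, Hf, Ht.
    - destruct IHf as (f' & Hf' & Df), IHg as (g' & Hg' & Dg).
      exists (fun t => f' t + g' t). split; [now apply closure_plus|].
      intros t Ht. apply (is_derive_plus f g t); auto.
    - destruct IHf as (f' & Hf' & Df), IHg as (g' & Hg' & Dg).
      exists (fun t => f' t * g t + f t * g' t).
      split; [apply closure_plus; now apply closure_mult|].
      intros t Ht. apply (is_derive_mult f g t); auto. intros; apply Rmult_comm.
    - destruct IHf as (f' & Hf' & Df).
      exists (fun t => f' t * Derive phi (f t)). split.
      + apply closure_mult; [assumption|]. apply closure_comp with V; try assumption.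
        intros t Ht. exact (smooth_at_Derive phi t (HV t Ht)).
      + intros t Ht. apply (is_derive_comp phi f t); [|auto].
        apply Derive_correct, smooth_at_ex_derive, HV, HUV, Ht. }
  assert (Hn : forall n f, differential_closure B U f -> forall t, U t -> ex_derive_n f n t).
  { induction n as [|n IH]; intros f Hf t Ht; [exact I|].
    destruct (Hder f Hf) as (f' & Hf' & Df).
    destruct n as [|n]; [exists (f' t); auto|].
    assert (Hd : ex_derive_n (Derive f) (S n) t).
    { apply (ex_derive_n_ext_loc f' (Derive f)); [|auto].
      generalize (HU t Ht). apply filter_imp. intros s Hs. symmetry.
      apply is_derive_unique. auto. }
    simpl in Hd |- *. apply (ex_derive_ext (Derive_n (Derive f) n)); [|exact Hd].
    intros s. etransitivity; [exact (Derive_n_comp f n 1 s)|].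
    now rewrite Nat.add_1_r. }
  intros f Hf u Hu. generalize (HU u Hu). apply filter_imp. auto.
Qed.

Lemma open_and_smooth_at f g : open (fun t => smooth_at f t /\ smooth_at g t).
Proof. intros t [H1 H2]. apply filter_and; now apply smooth_at_locally. Qed.

Lemma smooth_at_plus f g u :
  smooth_at f u -> smooth_at g u -> smooth_at (fun t => f t + g t) u.
Proof.
  intros Hf Hg.
  apply (differential_closure_smooth (fun _ => False) _ (open_and_smooth_at f g));
    [intros ? []| |tauto].
  apply closure_plus; apply closure_smooth; now intros t [].
Qed.

Lemma smooth_at_mult f g u :
  smooth_at f u -> smooth_at g u -> smooth_at (fun t => f t * g t) u.
Proof.
  intros Hf Hg.
  apply (differential_closure_smooth (fun _ => False) _ (open_and_smooth_at f g));
    [intros ? []| |tauto].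
  apply closure_mult; apply closure_smooth; now intros t [].
Qed.

Lemma smooth_at_comp phi f u :
  smooth_at f u -> smooth_at phi (f u) -> smooth_at (fun t => phi (f t)) u.
Proof.
  intros Hf Hphi.
  apply (differential_closure_smooth (fun _ => False)
    (fun t => smooth_at f t /\ smooth_at phi (f t))); [|intros ? []| |tauto].
  - intros t [H1 H2]. apply filter_and; [now apply smooth_at_locally|].
    apply (smooth_at_continuous f t H1 (smooth_at phi)). now apply smooth_at_locally.
  - apply closure_comp with (smooth_at phi); [easy| |tauto].
    apply closure_smooth. now intros t [].
Qed.

Lemma smooth_at_const c u : smooth_at (fun _ => c) u.
Proof. apply (filter_forall (F := locally u)). intros t n. apply ex_derive_n_const. Qed.

Lemma smooth_at_scal c f u : smooth_at f u -> smooth_at (fun t => c * f t) u.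
Proof. intros H. apply smooth_at_mult; [apply smooth_at_const|exact H]. Qed.

Lemma smooth_at_Rinv u : u <> 0 -> smooth_at Rinv u.
Proof.
  intros Hu.
  apply (differential_closure_smooth (fun f => f = Rinv) (fun t => t <> 0));
    [apply open_neq| | |exact Hu].
  - intros f ->. exists (fun t => -1 * (/ t * / t)). split.
    + apply closure_mult; [apply closure_smooth; intros t _; apply smooth_at_const|].
      now apply closure_mult; apply closure_base.
    + intros t Ht. auto_derive; [exact Ht|]. field. exact Ht.
  - now apply closure_base.
Qed.

Lemma smooth_at_sqrt u : 0 < u -> smooth_at sqrt u.
Proof.
  intros Hu.
  apply (differential_closure_smooth (fun f => f = sqrt) (fun t => 0 < t));
    [apply open_gt| | |exact Hu].
  - intros f ->. exists (fun t => / 2 * / sqrt t). split.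
    + apply closure_mult; [apply closure_smooth; intros t _; apply smooth_at_const|].
      apply (closure_comp _ _ (fun t => t <> 0) Rinv sqrt).
      * intros t Ht. exact (smooth_at_Rinv t Ht).
      * now apply closure_base.
      * intros t Ht. apply Rgt_not_eq, sqrt_lt_R0, Ht.
    + intros t Ht. auto_derive; [exact Ht|]. field. apply Rgt_not_eq, sqrt_lt_R0, Ht.
  - now apply closure_base.
Qed.

(** Covers at once the circular and the hyperbolic functions. *)
Lemma smooth_at_of_linear_system (sh ch : R -> R) (a b u : R) :
  (forall t, is_derive sh t (a * ch t)) -> (forall t, is_derive ch t (b * sh t)) ->
  smooth_at sh u /\ smooth_at ch u.
Proof.
  intros HS HC.
  assert (H : forall f, differential_closure (fun f => f = sh \/ f = ch) (fun _ => True) f ->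
                smooth_at f u).
  { intros f Hf.
    apply (differential_closure_smooth (fun f => f = sh \/ f = ch) (fun _ => True));
      [apply open_true| |exact Hf|exact I].
    clear f Hf. intros f [->| ->].
    - exists (fun t => a * ch t). split; [|intros t _; apply HS].
      apply closure_mult; [apply closure_smooth; intros t _; apply smooth_at_const|].
      apply closure_base; tauto.
    - exists (fun t => b * sh t). split; [|intros t _; apply HC].
      apply closure_mult; [apply closure_smooth; intros t _; apply smooth_at_const|].
      apply closure_base; tauto. }
  split; apply H; apply closure_base; tauto.
Qed.

(** * Functions which agree on an interval *)

Lemma interval_has_nearby_point (J : R -> Prop) u d : is_interval J -> J u -> 0 < d ->
  exists w, J w /\ w <> u /\ Rabs (w - u) < d.
Proof.
  intros [(a & b & Ha & Hb & Hab) Hconv] Hu Hd.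
  destruct (Rlt_le_dec u b) as [Hub|Hbu].
  - assert (Hub0 : 0 < b - u) by lra.
    assert (H := Rmin_glb_lt _ _ _ Hub0 (Rdiv_lt_0_compat d 2 Hd Rlt_0_2)).
    assert (Hl := Rmin_l (b - u) (d / 2)). assert (Hr := Rmin_r (b - u) (d / 2)).
    exists (u + Rmin (b - u) (d / 2)). split; [apply (Hconv u b); auto; lra|split; [lra|]].
    rewrite Rabs_pos_eq; lra.
  - assert (Hau : 0 < u - a) by lra.
    assert (H := Rmin_glb_lt _ _ _ Hau (Rdiv_lt_0_compat d 2 Hd Rlt_0_2)).
    assert (Hl := Rmin_l (u - a) (d / 2)). assert (Hr := Rmin_r (u - a) (d / 2)).
    exists (u - Rmin (u - a) (d / 2)). split; [apply (Hconv a u); auto; lra|split; [lra|]].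
    rewrite Rabs_left1; lra.
Qed.

(** At an endpoint of [J] the two functions may differ on the other side, but
    difference quotients taken inside [J] determine the two-sided derivative. *)
Lemma Derive_eq_on_interval (J : R -> Prop) (f1 f2 : R -> R) u :
  is_interval J -> (forall t, J t -> f1 t = f2 t) -> J u ->
  ex_derive f1 u -> ex_derive f2 u -> Derive f1 u = Derive f2 u.
Proof.
  intros HJ Heq Hu H1 H2.
  destruct (Req_dec (Derive f1 u) (Derive f2 u)) as [|Hne]; [assumption|exfalso].
  assert (Hd := is_derive_minus f1 f2 u _ _ (Derive_correct _ _ H1) (Derive_correct _ _ H2)).
  apply is_derive_Reals in Hd.
  assert (Hpos : 0 < Rabs (Derive f1 u - Derive f2 u)) by (apply Rabs_pos_lt; lra).
  destruct (Hd _ Hpos) as [d Hdd].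
  destruct (interval_has_nearby_point J u d HJ Hu (cond_pos d)) as (w & Hw & Hwu & Hwd).
  specialize (Hdd (w - u) ltac:(lra) Hwd). replace (u + (w - u)) with w in Hdd by ring.
  unfold minus, plus, opp in Hdd; simpl in Hdd.
  rewrite (Heq w Hw), (Heq u Hu) in Hdd.
  match type of Hdd with Rabs ?x < _ => replace x with (- (Derive f1 u - Derive f2 u)) in Hdd end.
  - rewrite Rabs_Ropp in Hdd. lra.
  - field. lra.
Qed.

Lemma chain_rule_on_interval (J : R -> Prop) (f g h : R -> R) :
  is_interval J -> smooth_on J f -> smooth_on J g ->
  (forall u, J u -> smooth_at h (g u)) -> (forall u, J u -> f u = h (g u)) ->
  forall u, J u ->
    Derive f u = Derive h (g u) * Derive g u /\
    Derive (Derive f) u =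
      Derive (Derive h) (g u) * Derive g u ^ 2 + Derive h (g u) * Derive (Derive g) u.
Proof.
  intros HJ Hf Hg Hh Heq.
  assert (comp : forall phi psi t, smooth_at phi (psi t) -> smooth_at psi t ->
    Derive (fun s => phi (psi s)) t = Derive psi t * Derive phi (psi t)).
  { intros phi psi t H1 H2. apply Derive_comp; apply smooth_at_ex_derive; assumption. }
  assert (H1 : forall u, J u -> Derive f u = Derive h (g u) * Derive g u).
  { intros u Hu. rewrite (Derive_eq_on_interval J f (fun t => h (g t)) u HJ Heq Hu).
    - rewrite comp; [ring|auto|exact (Hg u Hu)].
    - exact (smooth_at_ex_derive _ _ (Hf u Hu)).
    - exact (smooth_at_ex_derive _ _ (smooth_at_comp h g u (Hg u Hu) (Hh u Hu))). }
  intros u Hu. split; [exact (H1 u Hu)|].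
  assert (Sg := smooth_at_Derive g u (Hg u Hu)).
  assert (Sh := smooth_at_Derive h _ (Hh u Hu)).
  assert (Shg := smooth_at_comp _ g u (Hg u Hu) Sh).
  rewrite (Derive_eq_on_interval J (Derive f) (fun t => Derive h (g t) * Derive g t) u HJ H1 Hu).
  - rewrite Derive_mult; try now apply smooth_at_ex_derive.
    rewrite comp; [ring|exact Sh|exact (Hg u Hu)].
  - exact (smooth_at_ex_derive _ _ (smooth_at_Derive _ _ (Hf u Hu))).
  - exact (smooth_at_ex_derive _ _ (smooth_at_mult _ _ _ Shg Sg)).
Qed.

(** * Inverse functions and graphs *)

Definition convex (U : R -> Prop) : Prop := forall a b t, U a -> U b -> a <= t <= b -> U t.

(** The points joined to [J] by a segment inside [P] form such a set. *)
Lemma convex_open_neighborhood (J P : R -> Prop) :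
  convex J -> open P -> (forall u, J u -> P u) ->
  exists U, open U /\ convex U /\ (forall u, J u -> U u) /\ (forall u, U u -> P u).
Proof.
  intros HJ HP HJP.
  exists (fun t => exists u, J u /\ forall s, Rmin u t <= s <= Rmax u t -> P s).
  split; [|split; [|split]].
  - intros t (u & Hu & Hseg).
    destruct (HP t) as [d Hd]; [apply Hseg; split; [apply Rmin_r|apply Rmax_r]|].
    exists d. intros t' Ht'. exists u. split; [exact Hu|]. intros s Hs.
    destruct (Rlt_le_dec (Rabs (s - t)) d) as [Hst|Hst]; [exact (Hd s Hst)|].
    apply Hseg. change (Rabs (t' - t) < d) in Ht'. revert Hs Hst Ht'.
    unfold Rmin, Rmax, Rabs. destruct (Rle_dec u t'), (Rle_dec u t); repeat destruct Rcase_abs; lra.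
  - intros a b t (u & Hu & Ha) (w & Hw & Hb) Ht.
    destruct (Rle_lt_dec t u) as [Htu|Hut]; [|destruct (Rle_lt_dec w t) as [Hwt|Htw]].
    + exists u. split; [exact Hu|]. intros s Hs. apply Ha. revert Hs.
      unfold Rmin, Rmax. destruct (Rle_dec u t), (Rle_dec u a); lra.
    + exists w. split; [exact Hw|]. intros s Hs. apply Hb. revert Hs.
      unfold Rmin, Rmax. destruct (Rle_dec w t), (Rle_dec w b); lra.
    + assert (Hjt : J t) by (apply (HJ u w); auto; lra).
      exists t. split; [exact Hjt|]. intros s Hs. rewrite Rmin_left, Rmax_left in Hs by lra.
      replace s with t by lra. auto.
  - intros u Hu. exists u. split; [exact Hu|]. intros s Hs.
    rewrite Rmin_left, Rmax_left in Hs by lra. replace s with u by lra. auto.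
  - intros t (u & Hu & Hseg). apply Hseg. split; [apply Rmin_r|apply Rmax_r].
Qed.

Lemma injective_of_Derive_neq_0 (U : R -> Prop) (g : R -> R) : convex U -> smooth_on U g ->
  (forall t, U t -> Derive g t <> 0) -> forall a b, U a -> U b -> g a = g b -> a = b.
Proof.
  intros HU Hg Hg'.
  assert (Hlt : forall a b, U a -> U b -> g a = g b -> ~ a < b).
  { intros a b Ha Hb Heq Hab.
    assert (Hab' : forall t, Rmin a b <= t <= Rmax a b -> U t).
    { intros t. rewrite Rmin_left, Rmax_right by lra. now apply HU. }
    destruct (MVT_gen g a b (Derive g)) as (c & Hc & E).
    - intros t Ht. apply Derive_correct, (smooth_at_ex_derive g t), Hg, Hab'. lra.
    - intros t Ht. apply continuity_pt_filterlim, smooth_at_continuous, Hg, Hab', Ht.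
    - rewrite Heq, Rminus_diag in E.
      apply (Rmult_integral_contrapositive (Derive g c) (b - a)); [|congruence].
      split; [auto|lra]. }
  intros a b Ha Hb Heq. destruct (Rtotal_order a b) as [H|[H|H]]; [|exact H|]; exfalso.
  - exact (Hlt a b Ha Hb Heq H).
  - exact (Hlt b a Hb Ha (eq_sym Heq) H).
Qed.

(** Near [t0] the sign of [g'] is constant, so on both sides of [t0] the values
    of [g] move away from [g t0], in opposite directions, by at least half the
    amount predicted by the tangent line; the intermediate value theorem does
    the rest. *)
Lemma locally_surjective (g : R -> R) t0 d : smooth_at g t0 -> Derive g t0 <> 0 -> 0 < d ->
  locally (g t0) (fun y => exists t, Rabs (t - t0) < d /\ g t = y).
Proof.
  intros Hg Hg' Hd. set (a := Derive g t0) in *.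
  assert (Ha2 : 0 < a ^ 2) by (apply pow2_gt_0; exact Hg').
  assert (Hloc : locally t0 (fun t => smooth_at g t /\ a ^ 2 / 2 < a * Derive g t)).
  { apply filter_and; [now apply smooth_at_locally|].
    apply (smooth_at_continuous (fun t => a * Derive g t) t0) with (P := fun y => a ^ 2 / 2 < y).
    - apply smooth_at_scal, smooth_at_Derive, Hg.
    - apply open_gt. fold a. nra. }
  destruct Hloc as [r Hr]. set (e := Rmin d r / 2).
  assert (He : 0 < e /\ e < d /\ e < r).
  { assert (H := Rmin_stable_in_posreal (mkposreal d Hd) r). simpl in H.
    assert (Hl := Rmin_l d r). assert (H2 := Rmin_r d r). unfold e. lra. }
  destruct He as (He & Hed & Her).
  assert (Hball : forall t, Rabs (t - t0) <= e -> smooth_at g t /\ a ^ 2 / 2 < a * Derive g t).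
  { intros t Ht. apply Hr. change (Rabs (t - t0) < r). lra. }
  assert (Hmvt := MVT_cor4 g (Derive g) t0 e
    (fun c Hc => Derive_correct _ _ (smooth_at_ex_derive _ _ (proj1 (Hball c Hc))))).
  assert (Hplus : Rabs (t0 + e - t0) = e) by (rewrite Rabs_pos_eq; lra).
  assert (Hminus : Rabs (t0 - e - t0) = e) by (rewrite Rabs_left1; lra).
  destruct (Hmvt (t0 + e)) as (c1 & E1 & K1); [lra|].
  destruct (Hmvt (t0 - e)) as (c2 & E2 & K2); [lra|].
  rewrite Hplus in K1. rewrite Hminus in K2.
  apply Hball in K1, K2. destruct K1 as [_ K1], K2 as [_ K2].
  assert (Heta : 0 < a ^ 2 / 2 * e / Rabs a).
  { apply Rdiv_lt_0_compat; [nra|now apply Rabs_pos_lt]. }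
  exists (mkposreal _ Heta). intros y Hy. change (Rabs (y - g t0) < a ^ 2 / 2 * e / Rabs a) in Hy.
  assert (Hy' : Rabs (a * (g t0 - y)) < a ^ 2 / 2 * e).
  { rewrite Rabs_mult, Rabs_minus_sym, Rmult_comm. apply Rlt_div_r in Hy; [exact Hy|].
    now apply Rabs_pos_lt. }
  apply Rabs_def2 in Hy'.
  (* multiplying by [a] makes the function increasing whatever the sign of [a] *)
  destruct (IVT_interv (fun t => a * (g t - y)) (t0 - e) (t0 + e)) as (t & Ht & E).
  - intros t Ht. apply continuity_pt_filterlim.
    apply (smooth_at_continuous (fun t => a * (g t - y))), smooth_at_scal.
    apply smooth_at_plus; [apply Hball, Rabs_le; lra|apply smooth_at_const].
  - lra.
  - replace (a * (g (t0 - e) - y)) with (a * (g t0 - y) + a * (g (t0 - e) - g t0)) by ring.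
    rewrite E2. nra.
  - replace (a * (g (t0 + e) - y)) with (a * (g t0 - y) + a * (g (t0 + e) - g t0)) by ring.
    rewrite E1. nra.
  - exists t. split; [apply Rle_lt_trans with e; [apply Rabs_le|]; lra|].
    apply Rmult_integral in E. destruct E; [contradiction|lra].
Qed.

(** The inverse [k] solves [k' = 1 / g'(k)], so its smoothness is an instance
    of [differential_closure_smooth]. *)
Lemma smooth_inverse (U : R -> Prop) (g : R -> R) : open U -> convex U -> smooth_on U g ->
  (forall t, U t -> Derive g t <> 0) ->
  exists k, forall t, U t -> k (g t) = t /\ smooth_at k (g t).
Proof.
  intros HU Hconv Hg Hg'.
  set (k := fun y => epsilon (inhabits 0) (fun t => U t /\ g t = y)).
  assert (Hk : forall t, U t -> k (g t) = t).
  { intros t Ht.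
    destruct (epsilon_spec (inhabits 0) (fun s => U s /\ g s = g t)) as [H1 H2]; [now exists t|].
    exact (injective_of_Derive_neq_0 U g Hconv Hg Hg' _ _ H1 Ht H2). }
  set (V := fun y => exists t, U t /\ g t = y).
  assert (Hnear : forall t d, U t -> 0 < d ->
    locally (g t) (fun y => exists s, U s /\ Rabs (s - t) < d /\ g s = y)).
  { intros t d Ht Hd. destruct (HU t Ht) as [r Hr].
    assert (Hrd : 0 < Rmin d r) by (apply Rmin_glb_lt; [exact Hd|apply cond_pos]).
    generalize (locally_surjective g t (Rmin d r) (Hg t Ht) (Hg' t Ht) Hrd).
    apply filter_imp. intros y (s & Hs & E). exists s. split; [|split; [|exact E]].
    - apply Hr. apply Rlt_le_trans with (1 := Hs), Rmin_r.
    - apply Rlt_le_trans with (1 := Hs), Rmin_l. }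
  assert (HV : open V).
  { intros y (t & Ht & <-). generalize (Hnear t 1 Ht Rlt_0_1). apply filter_imp.
    intros y (s & Hs & _ & E). now exists s. }
  assert (Hinv : forall t, U t -> smooth_at (fun s => / Derive g s) t).
  { intros t Ht. apply (smooth_at_comp Rinv (Derive g)).
    - exact (smooth_at_Derive g t (Hg t Ht)).
    - exact (smooth_at_Rinv _ (Hg' t Ht)). }
  assert (Hder : forall y, V y -> is_derive k y (/ Derive g (k y))).
  { intros y0 (t0 & Ht0 & <-). rewrite (Hk t0 Ht0). apply is_derive_Reals. intros e He.
    assert (Hloc : locally t0 (fun c => U c /\ Rabs (/ Derive g c - / Derive g t0) < e)).
    { apply filter_and; [exact (HU t0 Ht0)|].
      apply (smooth_at_continuous _ _ (Hinv t0 Ht0) (fun y => Rabs (y - / Derive g t0) < e)).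
      exists (mkposreal e He). trivial. }
    destruct Hloc as [r Hr].
    destruct (Hnear t0 r Ht0 (cond_pos r)) as [d Hd]. exists d. intros h Hh Hhd.
    destruct (Hd (g t0 + h)) as (t & Ht & Htr & E).
    { change (Rabs (g t0 + h - g t0) < d). now replace (g t0 + h - g t0) with h by ring. }
    rewrite <- E, (Hk t Ht), (Hk t0 Ht0).
    (* by the mean value theorem the difference quotient of [k] is [1 / g' c]
       with [c] between [t0] and [t], hence close to [1 / g' t0] *)
    destruct (MVT_cor4 g (Derive g) t0 (Rabs (t - t0))) with (b := t) as (c & Ec & Hc).
    { intros c Hc. apply Derive_correct, (smooth_at_ex_derive g c), Hg, Hr.
      change (Rabs (c - t0) < r). lra. }
    { lra. }
    destruct (Hr c) as [Hcu Hce]; [change (Rabs (c - t0) < r); lra|].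
    replace h with (Derive g c * (t - t0)) by lra.
    assert (Hgc := Hg' c Hcu).
    assert (Htt : t - t0 <> 0) by (intros E0; rewrite E0, Rmult_0_r in Ec; lra).
    replace ((t - t0) / (Derive g c * (t - t0))) with (/ Derive g c) by (field; tauto).
    exact Hce. }
  exists k. intros t Ht. split; [exact (Hk t Ht)|].
  apply (differential_closure_smooth (fun f => f = k) V HV); [| |now exists t].
  - intros f ->. exists (fun y => / Derive g (k y)). split; [|exact Hder].
    apply (closure_comp _ _ U (fun s => / Derive g s) k).
    + exact Hinv.
    + now apply closure_base.
    + intros y (s & Hs & <-). now rewrite Hk.
  - now apply closure_base.
Qed.

Definition image (J : R -> Prop) (g : R -> R) (y : R) : Prop := exists u, J u /\ g u = y.

Lemma is_interval_image (J : R -> Prop) (g : R -> R) : is_interval J -> smooth_on J g ->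
  (forall u, J u -> Derive g u <> 0) -> is_interval (image J g).
Proof.
  intros [(a & b & Ha & Hb & Hab) Hconv] Hg Hg'. split.
  - assert (Hne : g a <> g b).
    { intros E. apply (injective_of_Derive_neq_0 J g Hconv Hg Hg' a b Ha Hb) in E. lra. }
    destruct (Rlt_le_dec (g a) (g b)) as [H|H].
    + exists (g a), (g b). split; [now exists a|split; [now exists b|exact H]].
    + exists (g b), (g a). split; [now exists b|split; [now exists a|lra]].
  - intros y1 y2 y (u & Hu & <-) (w & Hw & <-) Hy.
    destruct (Req_dec y (g u)) as [->|Hyu]; [now exists u|].
    destruct (Req_dec y (g w)) as [->|Hyw]; [now exists w|].
    assert (Hcont : forall k t, J t -> continuity_pt (fun s => k * (g s - y)) t).
    { intros k t Ht. apply continuity_pt_filterlim.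
      apply (smooth_at_continuous (fun s => k * (g s - y))), smooth_at_scal.
      apply smooth_at_plus; [exact (Hg t Ht)|apply smooth_at_const]. }
    destruct (Rtotal_order u w) as [H|[H|H]].
    + destruct (IVT_interv (fun s => 1 * (g s - y)) u w) as (t & Ht & E); try lra.
      { intros t Ht. apply Hcont. now apply (Hconv u w). }
      exists t. split; [now apply (Hconv u w)|lra].
    + subst w. exfalso. lra.
    + destruct (IVT_interv (fun s => -1 * (g s - y)) w u) as (t & Ht & E); try lra.
      { intros t Ht. apply Hcont. now apply (Hconv w u). }
      exists t. split; [now apply (Hconv w u)|lra].
Qed.

(** The inverse of [g] is taken on an open interval around [J] on which the
    hypotheses persist; this makes [h] smooth across endpoints of the image. *)
Lemma graph_over_image (J : R -> Prop) (f g : R -> R) : is_interval J ->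
  smooth_on J f -> smooth_on J g -> (forall u, J u -> Derive g u <> 0) ->
  exists h, smooth_on (image J g) h /\ forall u, J u -> f u = h (g u).
Proof.
  intros HJ Hf Hg Hg'.
  destruct (convex_open_neighborhood J
    (fun t => (smooth_at f t /\ smooth_at g t) /\ Derive g t <> 0))
    as (U & HU & HUc & HJU & HUP).
  - exact (proj2 HJ).
  - intros t [[H1 H2] H3]. apply filter_and; [apply filter_and; now apply smooth_at_locally|].
    apply (smooth_at_continuous _ _ (smooth_at_Derive g t H2) (fun y => y <> 0)).
    now apply open_neq.
  - intros u Hu. split; [split; [exact (Hf u Hu)|exact (Hg u Hu)]|exact (Hg' u Hu)].
  - destruct (smooth_inverse U g HU HUc) as (k & Hk).
    + intros t Ht. exact (proj2 (proj1 (HUP t Ht))).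
    + intros t Ht. exact (proj2 (HUP t Ht)).
    + exists (fun y => f (k y)). split.
      * intros y (u & Hu & <-). destruct (Hk u (HJU u Hu)) as [E Hs].
        apply (smooth_at_comp f k); [exact Hs|]. rewrite E. exact (Hf u Hu).
      * intros u Hu. now rewrite (proj1 (Hk u (HJU u Hu))).
Qed.

(** * Smooth functions of two variables *)

Lemma locally_2d_product (P Q : R -> Prop) u v :
  locally u P -> locally v Q -> locally_2d (fun s t => P s /\ Q t) u v.
Proof.
  intros [d1 H1] [d2 H2]. exists (mkposreal _ (Rmin_stable_in_posreal d1 d2)). simpl.
  intros s t Hs Ht. split.
  - apply H1. exact (Rlt_le_trans _ _ _ Hs (Rmin_l _ _)).
  - apply H2. exact (Rlt_le_trans _ _ _ Ht (Rmin_r _ _)).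
Qed.

Lemma differentiable_pt_product (phi psi : R -> R) u v :
  ex_derive phi u -> ex_derive psi v -> differentiable_pt (fun s t => phi s * psi t) u v.
Proof.
  intros [a Ha] [b Hb].
  assert (Hproj : differentiable_pt_lim (fun _ t => psi t) u v 0 b).
  { intros eps. apply is_derive_Reals in Hb. destruct (Hb eps (cond_pos eps)) as [d Hd].
    exists d. intros s t _ Ht. destruct (Req_dec (t - v) 0) as [H0|H0].
    - replace t with v by lra.
      replace (psi v - psi v - (0 * (s - u) + b * (v - v))) with 0 by ring.
      rewrite Rabs_R0. apply Rmult_le_pos; [left; apply cond_pos|].
      apply Rle_trans with (2 := Rmax_l _ _), Rabs_pos.
    - specialize (Hd (t - v) H0 Ht). replace (v + (t - v)) with t in Hd by ring.
      replace (psi t - psi v - (0 * (s - u) + b * (t - v)))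
        with (((psi t - psi v) / (t - v) - b) * (t - v)) by (field; exact H0).
      rewrite Rabs_mult. apply Rmult_le_compat; try apply Rabs_pos; [lra|apply Rmax_r]. }
  assert (Hmul : forall x y, differentiable_pt_lim Rmult x y y x).
  { intros x y eps. exists eps. intros s t _ Ht.
    replace (s * t - x * y - (y * (s - x) + x * (t - y))) with ((t - y) * (s - x)) by ring.
    rewrite Rabs_mult. apply Rmult_le_compat; try apply Rabs_pos; [lra|apply Rmax_l]. }
  exists (psi v * a + phi u * 0), (psi v * 0 + phi u * b).
  apply (differentiable_pt_lim_comp Rmult (fun s _ => phi s) (fun _ t => psi t)).
  - apply Hmul.
  - apply differentiable_pt_lim_proj1_0, is_derive_Reals, Ha.
  - exact Hproj.
Qed.

(** The formula needs no differentiability: [Derive] commutes with constant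
    factors unconditionally. *)
Lemma iter_partial_product (phi psi : R -> R) (w : list bool) :
  exists m n, forall s t,
    iter_partial w (fun s t => phi s * psi t) s t = Derive_n phi m s * Derive_n psi n t.
Proof.
  induction w as [|b w (m & n & IH)].
  - now exists 0%nat, 0%nat.
  - destruct b; [exists (S m), n|exists m, (S n)]; intros s t; simpl.
    + unfold du. rewrite (Derive_ext _ (fun s => Derive_n phi m s * Derive_n psi n t)) by auto.
      apply Derive_scal_l.
    + unfold dv. rewrite (Derive_ext _ (fun t => Derive_n phi m s * Derive_n psi n t)) by auto.
      apply Derive_scal.
Qed.

Lemma smooth_near_product (phi psi : R -> R) u v :
  smooth_at phi u -> smooth_at psi v -> smooth_near (fun s t => phi s * psi t) u v.
Proof.
  intros Hphi Hpsi.
  apply (locally_2d_impl (fun s t => smooth_at phi s /\ smooth_at psi t)).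
  - apply locally_2d_forall. intros s t [Hs Ht] w.
    destruct (iter_partial_product phi psi w) as (m & n & Hw).
    replace (iter_partial w (fun s t => phi s * psi t))
      with (fun s t => Derive_n phi m s * Derive_n psi n t).
    + apply differentiable_pt_product; apply smooth_at_ex_derive, smooth_at_Derive_n; assumption.
    + extensionality a. extensionality b. symmetry. apply Hw.
  - apply locally_2d_product; now apply smooth_at_locally.
Qed.

Lemma smooth_near_const (c : R) s t : smooth_near (fun _ _ => c) s t.
Proof.
  replace (fun _ _ : R => c) with (fun _ _ : R => c * 1).
  - exact (smooth_near_product (fun _ => c) (fun _ => 1) s t
      (smooth_at_const _ _) (smooth_at_const _ _)).
  - extensionality a. extensionality b. ring.
Qed.

Lemma iter_partial_app (w w' : list bool) (f : R -> R -> R) :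
  iter_partial (w ++ w') f = iter_partial w (iter_partial w' f).
Proof.
  induction w as [|[|] w IH]; simpl; [reflexivity| |]; now rewrite IH.
Qed.

Lemma smooth_near_iter_partial (w : list bool) f u v :
  smooth_near f u v -> smooth_near (iter_partial w f) u v.
Proof.
  apply locally_2d_impl, locally_2d_forall. intros s t H w'.
  rewrite <- iter_partial_app. apply H.
Qed.

Lemma smooth_near_du f u v : smooth_near f u v -> smooth_near (du f) u v.
Proof. exact (smooth_near_iter_partial (true :: nil) f u v). Qed.

Lemma smooth_near_dv f u v : smooth_near f u v -> smooth_near (dv f) u v.
Proof. exact (smooth_near_iter_partial (false :: nil) f u v). Qed.

Lemma differentiable_pt_is_derive (f : R -> R -> R) u v :
  differentiable_pt f u v ->
  is_derive (fun s => f s v) u (du f u v) /\ is_derive (fun t => f u t) v (dv f u v).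
Proof.
  intros (lx & ly & H). destruct (differentiable_pt_lim_unique f u v lx ly H) as [E1 E2].
  unfold du, dv. rewrite E1, E2. split; apply is_derive_Reals.
  - replace lx with (lx * 1 + ly * 0) by ring.
    apply (derivable_pt_lim_comp_2d f (fun s => s) (fun _ => v) u); [exact H| |].
    + apply derivable_pt_lim_id.
    + apply derivable_pt_lim_const.
  - replace ly with (lx * 0 + ly * 1) by ring.
    apply (derivable_pt_lim_comp_2d f (fun _ => u) (fun t => t) v); [exact H| |].
    + apply derivable_pt_lim_const.
    + apply derivable_pt_lim_id.
Qed.

Lemma smooth_near_differentiable f u v : smooth_near f u v -> differentiable_pt f u v.
Proof. intros H. exact (locally_2d_singleton _ _ _ H nil). Qed.

(** Schwarz's theorem. *)
Lemma smooth_near_dv_du f u v : smooth_near f u v -> dv (du f) u v = du (dv f) u v.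
Proof.
  intros H. symmetry. apply (Schwarz f u v).
  - revert H. apply locally_2d_impl, locally_2d_forall. intros s t H.
    destruct (differentiable_pt_is_derive _ _ _ (H nil)) as [H1 H2].
    destruct (differentiable_pt_is_derive _ _ _ (H (true :: nil))) as [_ H3].
    destruct (differentiable_pt_is_derive _ _ _ (H (false :: nil))) as [H4 _].
    split; [|split; [|split]]; eexists; eassumption.
  - apply differentiable_continuity_pt.
    exact (locally_2d_singleton _ _ _ H (true :: false :: nil)).
  - apply differentiable_continuity_pt.
    exact (locally_2d_singleton _ _ _ H (false :: true :: nil)).
Qed.

(** * Vector calculus in Minkowski space *)

Definition is_vderive (c : R -> R4) (s : R) (d : R4) : Prop :=
  is_derive (fun t => x1 (c t)) s (x1 d) /\ is_derive (fun t => x2 (c t)) s (x2 d) /\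
  is_derive (fun t => x3 (c t)) s (x3 d) /\ is_derive (fun t => x4 (c t)) s (x4 d).

Lemma mink_comm p q : mink p q = mink q p.
Proof. unfold mink. ring. Qed.

Lemma mink_plus_l p q r : mink (plus p q) r = mink p r + mink q r.
Proof.
  destruct p as [[[p1 p2] p3] p4], q as [[[q1 q2] q3] q4].
  unfold mink, x1, x2, x3, x4, plus; simpl. unfold plus; simpl. ring.
Qed.

Lemma mink_scal_l a p r : mink (scal a p) r = a * mink p r.
Proof.
  destruct p as [[[p1 p2] p3] p4].
  unfold mink, x1, x2, x3, x4, scal; simpl. unfold scal; simpl. unfold mult; simpl. ring.
Qed.

Lemma mink_minus_l p q r : mink (minus p q) r = mink p r - mink q r.
Proof.
  destruct p as [[[p1 p2] p3] p4], q as [[[q1 q2] q3] q4].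
  unfold mink, x1, x2, x3, x4, minus, plus, opp; simpl. unfold plus, opp; simpl. ring.
Qed.

Lemma mink_plus_r p q r : mink r (plus p q) = mink r p + mink r q.
Proof. rewrite mink_comm, mink_plus_l, (mink_comm p), (mink_comm q). reflexivity. Qed.

Lemma mink_scal_r a p r : mink r (scal a p) = a * mink r p.
Proof. rewrite mink_comm, mink_scal_l, (mink_comm p). reflexivity. Qed.

Lemma is_vderive_plus c e s c' e' :
  is_vderive c s c' -> is_vderive e s e' ->
  is_vderive (fun t => plus (c t) (e t)) s (plus c' e').
Proof.
  intros (?&?&?&?) (?&?&?&?).
  split; [|split; [|split]]; [apply (is_derive_plus (fun t => x1 (c t)) (fun t => x1 (e t)))
  |apply (is_derive_plus (fun t => x2 (c t)) (fun t => x2 (e t)))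
  |apply (is_derive_plus (fun t => x3 (c t)) (fun t => x3 (e t)))
  |apply (is_derive_plus (fun t => x4 (c t)) (fun t => x4 (e t)))]; assumption.
Qed.

Lemma is_vderive_minus c e s c' e' :
  is_vderive c s c' -> is_vderive e s e' ->
  is_vderive (fun t => minus (c t) (e t)) s (minus c' e').
Proof.
  intros (?&?&?&?) (?&?&?&?).
  split; [|split; [|split]]; [apply (is_derive_minus (fun t => x1 (c t)) (fun t => x1 (e t)))
  |apply (is_derive_minus (fun t => x2 (c t)) (fun t => x2 (e t)))
  |apply (is_derive_minus (fun t => x3 (c t)) (fun t => x3 (e t)))
  |apply (is_derive_minus (fun t => x4 (c t)) (fun t => x4 (e t)))]; assumption.
Qed.

Lemma is_vderive_scal (a : R -> R) (c : R -> R4) (s a' : R) (c' : R4) :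
  is_derive a s a' -> is_vderive c s c' ->
  is_vderive (fun t => scal (a t) (c t)) s (plus (scal a' (c s)) (scal (a s) c')).
Proof.
  intros Ha (?&?&?&?).
  split; [|split; [|split]]; [apply (is_derive_mult a (fun t => x1 (c t)))
  |apply (is_derive_mult a (fun t => x2 (c t)))
  |apply (is_derive_mult a (fun t => x3 (c t)))
  |apply (is_derive_mult a (fun t => x4 (c t)))]; try assumption; intros; apply Rmult_comm.
Qed.

Lemma is_derive_mink c e s c' e' :
  is_vderive c s c' -> is_vderive e s e' ->
  is_derive (fun t => mink (c t) (e t)) s (mink c' (e s) + mink (c s) e').
Proof.
  intros (H1&H2&H3&H4) (K1&K2&K3&K4). unfold mink.
  assert (M : forall a b a' b', is_derive a s a' -> is_derive b s b' ->
    is_derive (fun t => a t * b t) s (a' * b s + a s * b')).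
  { intros. apply (is_derive_mult a b); try assumption. intros; apply Rmult_comm. }
  evar_last.
  - apply (is_derive_minus (V := R_NormedModule)); [|exact (M _ _ _ _ H4 K4)].
    apply (is_derive_plus (V := R_NormedModule)); [|exact (M _ _ _ _ H3 K3)].
    apply (is_derive_plus (V := R_NormedModule)); [exact (M _ _ _ _ H1 K1)|exact (M _ _ _ _ H2 K2)].
  - unfold minus, plus, opp; simpl. ring.
Qed.

Lemma du4_unique z u v d : is_vderive (fun s => z s v) u d -> du4 z u v = d.
Proof.
  destruct d as [[[d1 d2] d3] d4]. intros (H1&H2&H3&H4).
  apply is_derive_unique in H1, H2, H3, H4.
  exact (f_equal2 pair (f_equal2 pair (f_equal2 pair H1 H2) H3) H4).
Qed.

Lemma dv4_unique z u v d : is_vderive (fun t => z u t) v d -> dv4 z u v = d.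
Proof.
  destruct d as [[[d1 d2] d3] d4]. intros (H1&H2&H3&H4).
  apply is_derive_unique in H1, H2, H3, H4.
  exact (f_equal2 pair (f_equal2 pair (f_equal2 pair H1 H2) H3) H4).
Qed.

Lemma smooth4_near_is_vderive z u v : smooth4_near z u v ->
  is_vderive (fun s => z s v) u (du4 z u v) /\ is_vderive (fun t => z u t) v (dv4 z u v).
Proof.
  intros (H1&H2&H3&H4).
  destruct (differentiable_pt_is_derive _ _ _ (smooth_near_differentiable _ _ _ H1)).
  destruct (differentiable_pt_is_derive _ _ _ (smooth_near_differentiable _ _ _ H2)).
  destruct (differentiable_pt_is_derive _ _ _ (smooth_near_differentiable _ _ _ H3)).
  destruct (differentiable_pt_is_derive _ _ _ (smooth_near_differentiable _ _ _ H4)).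
  split; (split; [|split; [|split]]); assumption.
Qed.

Lemma smooth4_near_du4 z u v : smooth4_near z u v -> smooth4_near (du4 z) u v.
Proof. intros (?&?&?&?). repeat split; now apply smooth_near_du. Qed.

Lemma smooth4_near_dv4 z u v : smooth4_near z u v -> smooth4_near (dv4 z) u v.
Proof. intros (?&?&?&?). repeat split; now apply smooth_near_dv. Qed.

Lemma smooth4_near_dv4_du4 z u v : smooth4_near z u v -> dv4 (du4 z) u v = du4 (dv4 z) u v.
Proof.
  intros (H1&H2&H3&H4). 
  generalize (smooth_near_dv_du _ _ _ H1) (smooth_near_dv_du _ _ _ H2)
    (smooth_near_dv_du _ _ _ H3) (smooth_near_dv_du _ _ _ H4).
  intros E1 E2 E3 E4.
  exact (f_equal2 pair (f_equal2 pair (f_equal2 pair E1 E2) E3) E4).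
Qed.

(** * The Ricci equation *)

Definition gram_det (zu zv : R4) : R := mink zu zu * mink zv zv - mink zu zv ^ 2.

Definition coef_u (zu zv w : R4) : R :=
  (mink zv zv * mink w zu - mink zu zv * mink w zv) / gram_det zu zv.

Definition coef_v (zu zv w : R4) : R :=
  (mink zu zu * mink w zv - mink zu zv * mink w zu) / gram_det zu zv.

Definition normal_projection (zu zv w : R4) : R4 :=
  minus w (plus (scal (coef_u zu zv w) zu) (scal (coef_v zu zv w) zv)).

Lemma mink_normal_projection zu zv w m :
  mink zu m = 0 -> mink zv m = 0 -> mink (normal_projection zu zv w) m = mink w m.
Proof.
  intros Hu Hv. unfold normal_projection.
  rewrite mink_minus_l, mink_plus_l, !mink_scal_l, Hu, Hv. ring.
Qed.

Lemma ex_derive_coef (Zu Zv W : R -> R4) (s : R) (Zu' Zv' W' : R4) :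
  is_vderive Zu s Zu' -> is_vderive Zv s Zv' -> is_vderive W s W' ->
  gram_det (Zu s) (Zv s) <> 0 ->
  ex_derive (fun t => coef_u (Zu t) (Zv t) (W t)) s /\
  ex_derive (fun t => coef_v (Zu t) (Zv t) (W t)) s.
Proof.
  intros HZu HZv HW Hdet.
  assert (M : forall c e c' e', is_vderive c s c' -> is_vderive e s e' ->
                ex_derive (fun t => mink (c t) (e t)) s).
  { intros c e c' e' Hc He. eexists. exact (is_derive_mink _ _ _ _ _ Hc He). }
  assert (HE := M _ _ _ _ HZu HZu). assert (HF := M _ _ _ _ HZu HZv).
  assert (HG := M _ _ _ _ HZv HZv). assert (Hu := M _ _ _ _ HW HZu).
  assert (Hv := M _ _ _ _ HW HZv).
  assert (P : forall a b : R -> R, ex_derive a s -> ex_derive b s ->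
                ex_derive (fun t => a t * b t) s).
  { intros a b Ha Hb. now apply (ex_derive_mult a b). }
  assert (D : ex_derive (fun t => gram_det (Zu t) (Zv t)) s).
  { apply (ex_derive_minus (V := R_NormedModule)); [now apply P|].
    apply (ex_derive_pow (fun t => mink (Zu t) (Zv t))). exact HF. }
  split; apply ex_derive_div; try assumption;
    apply (ex_derive_minus (V := R_NormedModule)); now apply P.
Qed.

(** The derivative of the normal part of a vector field, paired with a normal
    vector [m]: the derivatives of the two coefficients of the tangential part disappear
    because they multiply tangent vectors, and only the second derivatives of
    the surface, carried by [Zu'] and [Zv'], survive. *)
Lemma vderive_normal_projection (Zu Zv Nu Nv : R -> R4) (p q : R -> R) (s : R)
  (Zu' Zv' Nu' Nv' m : R4) (p' q' : R) :
  is_vderive Zu s Zu' -> is_vderive Zv s Zv' ->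
  is_vderive Nu s Nu' -> is_vderive Nv s Nv' ->
  is_derive p s p' -> is_derive q s q' ->
  gram_det (Zu s) (Zv s) <> 0 -> mink (Zu s) m = 0 -> mink (Zv s) m = 0 ->
  let W t := plus (scal (p t) (Nu t)) (scal (q t) (Nv t)) in
  exists d, is_vderive (fun t => normal_projection (Zu t) (Zv t) (W t)) s d /\
    mink d m = p' * mink (Nu s) m + p s * mink Nu' m + q' * mink (Nv s) m + q s * mink Nv' m
      - (coef_u (Zu s) (Zv s) (W s) * mink Zu' m + coef_v (Zu s) (Zv s) (W s) * mink Zv' m).
Proof.
  intros HZu HZv HNu HNv Hp Hq Hdet Hum Hvm W.
  assert (HW := is_vderive_plus _ _ _ _ _ (is_vderive_scal _ _ _ _ _ Hp HNu)
                  (is_vderive_scal _ _ _ _ _ Hq HNv)).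
  destruct (ex_derive_coef Zu Zv W s _ _ _ HZu HZv HW Hdet) as [[a' Ha] [b' Hb]].
  eexists. split.
  - exact (is_vderive_minus _ _ _ _ _ HW
      (is_vderive_plus _ _ _ _ _ (is_vderive_scal _ _ _ _ _ Ha HZu)
        (is_vderive_scal _ _ _ _ _ Hb HZv))).
  - rewrite mink_minus_l, !mink_plus_l, !mink_scal_l, Hum, Hvm. ring.
Qed.

(** Turns derivatives of a normal field, paired with tangent vectors, into
    second fundamental forms. *)
Lemma mink_derivative_of_orthogonal (c e : R -> R4) (s : R) (c' e' : R4) :
  is_vderive c s c' -> is_vderive e s e' ->
  locally s (fun t => mink (c t) (e t) = 0) -> mink c' (e s) = - mink (c s) e'.
Proof.
  intros Hc He H0.
  assert (H := is_derive_unique _ _ _ (is_derive_mink _ _ _ _ _ Hc He)).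
  rewrite (Derive_ext_loc _ (fun _ => 0)), Derive_const in H by exact H0. lra.
Qed.

(** Valid for every parametrization with nondegenerate induced metric.  The
    terms with first derivatives of [X] and [Y] cancel against the bracket, those
    with second derivatives of [n1] cancel by Schwarz's theorem, and what is
    left is quadratic in the second fundamental form. *)
Theorem ricci_equation (z : R -> R -> R4) (X Y : tfield) (n1 n2 : R -> R -> R4) (u v : R) :
  smooth4_near z u v -> gram_det (du4 z u v) (dv4 z u v) <> 0 ->
  tangent_frame_near X Y u v -> normal_frame_near z n1 n2 u v ->
  let E := mink (du4 z u v) (du4 z u v) in
  let F := mink (du4 z u v) (dv4 z u v) in
  let G := mink (dv4 z u v) (dv4 z u v) in
  let c11 n := mink (du4 (du4 z) u v) n in
  let c12 n := mink (dv4 (du4 z) u v) n in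
  let c22 n := mink (dv4 (dv4 z) u v) n in
  let Delta1 := c11 (n1 u v) * c12 (n2 u v) - c12 (n1 u v) * c11 (n2 u v) in
  let Delta2 := c11 (n1 u v) * c22 (n2 u v) - c22 (n1 u v) * c11 (n2 u v) in
  let Delta3 := c12 (n1 u v) * c22 (n2 u v) - c22 (n1 u v) * c12 (n2 u v) in
  varkappa z X Y n1 n2 u v =
  - (G * Delta1 - F * Delta2 + E * Delta3) /
    ((fst X u v * snd Y u v - snd X u v * fst Y u v) * gram_det (du4 z u v) (dv4 z u v) ^ 2).
Proof.
  intros Hz Hdet (HXu & HXv & HYu & HYv & Hframe) (Hn1 & Hn2 & Hon).
  cbv zeta.
  apply locally_2d_singleton in Hframe.
  destruct (locally_2d_singleton _ _ _ Hon) as (H1u & H1v & H2u & H2v & _).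
  assert (Hzu := smooth4_near_du4 _ _ _ Hz). assert (Hzv := smooth4_near_dv4 _ _ _ Hz).
  assert (Hnu := smooth4_near_du4 _ _ _ Hn1). assert (Hnv := smooth4_near_dv4 _ _ _ Hn1).
  assert (Sz := smooth4_near_dv4_du4 _ _ _ Hz).
  assert (Sn := smooth4_near_dv4_du4 _ _ _ Hn1).
  destruct (smooth4_near_is_vderive _ _ _ Hzu) as [Dzuu Dzuv].
  destruct (smooth4_near_is_vderive _ _ _ Hzv) as [Dzvu Dzvv].
  destruct (smooth4_near_is_vderive _ _ _ Hnu) as [Dnuu Dnuv].
  destruct (smooth4_near_is_vderive _ _ _ Hnv) as [Dnvu Dnvv].
  destruct (smooth4_near_is_vderive _ _ _ Hn1) as [Dnu Dnv].
  destruct (differentiable_pt_is_derive _ _ _ (smooth_near_differentiable _ _ _ HXu))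
    as [DXuu DXuv].
  destruct (differentiable_pt_is_derive _ _ _ (smooth_near_differentiable _ _ _ HXv))
    as [DXvu DXvv].
  destruct (differentiable_pt_is_derive _ _ _ (smooth_near_differentiable _ _ _ HYu))
    as [DYuu DYuv].
  destruct (differentiable_pt_is_derive _ _ _ (smooth_near_differentiable _ _ _ HYv))
    as [DYvu DYvv].
  assert (Ou := locally_2d_impl _ (fun s t => mink (n1 s t) (du4 z s t) = 0) u v
    (locally_2d_forall _ _ _ (fun s t H => proj1 H)) Hon).
  assert (Ov := locally_2d_impl _ (fun s t => mink (n1 s t) (dv4 z s t) = 0) u v
    (locally_2d_forall _ _ _ (fun s t H => proj1 (proj2 H))) Hon).
  assert (Wuu := mink_derivative_of_orthogonal _ _ _ _ _ Dnu Dzuu (locally_2d_1d_const_y _ _ _ Ou)).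
  assert (Wuv := mink_derivative_of_orthogonal _ _ _ _ _ Dnu Dzvu (locally_2d_1d_const_y _ _ _ Ov)).
  assert (Wvu := mink_derivative_of_orthogonal _ _ _ _ _ Dnv Dzuv (locally_2d_1d_const_x _ _ _ Ou)).
  assert (Wvv := mink_derivative_of_orthogonal _ _ _ _ _ Dnv Dzvv (locally_2d_1d_const_x _ _ _ Ov)).
  rewrite mink_comm in H2u, H2v.
  destruct (vderive_normal_projection _ _ _ _ _ _ _ _ _ _ _ _ _ _
    Dzuu Dzvu Dnuu Dnvu DXuu DXvu Hdet H2u H2v) as (Xu' & KXu & EXu).
  destruct (vderive_normal_projection _ _ _ _ _ _ _ _ _ _ _ _ _ _
    Dzuv Dzvv Dnuv Dnvv DXuv DXvv Hdet H2u H2v) as (Xv' & KXv & EXv).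
  destruct (vderive_normal_projection _ _ _ _ _ _ _ _ _ _ _ _ _ _
    Dzuu Dzvu Dnuu Dnvu DYuu DYvu Hdet H2u H2v) as (Yu' & KYu & EYu).
  destruct (vderive_normal_projection _ _ _ _ _ _ _ _ _ _ _ _ _ _
    Dzuv Dzvv Dnuv Dnvv DYuv DYvv Hdet H2u H2v) as (Yv' & KYv & EYv).
  apply (du4_unique (normal_conn z X n1)) in KXu.
  apply (dv4_unique (normal_conn z X n1)) in KXv.
  apply (du4_unique (normal_conn z Y n1)) in KYu.
  apply (dv4_unique (normal_conn z Y n1)) in KYv.
  assert (N : forall V xi, mink (normal_conn z V xi u v) (n2 u v) =
     fst V u v * mink (du4 xi u v) (n2 u v) + snd V u v * mink (dv4 xi u v) (n2 u v)).
  { intros V xi.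
    transitivity (mink (ambient_conn V xi u v) (n2 u v)).
    - exact (mink_normal_projection _ _ _ _ H2u H2v).
    - unfold ambient_conn. now rewrite mink_plus_l, !mink_scal_l. }
  unfold varkappa, normal_curv, push.
  rewrite !mink_minus_l, !N, KXu, KXv, KYu, KYv, EXu, EXv, EYu, EYv.
  unfold bracket, lie_deriv. cbn [fst snd].
  unfold coef_u, coef_v.
  rewrite !mink_plus_l, !mink_scal_l, !mink_plus_r, !mink_scal_r.
  rewrite Wuu, Wuv, Wvu, Wvv, Sn, Sz.
  rewrite !(mink_comm (n1 u v)), (mink_comm (dv4 z u v) (du4 z u v)).
  revert Hdet. unfold gram_det. intros Hdet.
  field. repeat split; try assumption.
  (* the Gram determinant of [x, y] is that of the coordinate frame times the
     squared determinant of the components *)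
  match goal with |- ?t <> 0 =>
    replace t with ((fst X u v * snd Y u v - snd X u v * fst Y u v) ^ 2 *
      (mink (du4 z u v) (du4 z u v) * mink (dv4 z u v) (dv4 z u v) -
       mink (du4 z u v) (dv4 z u v) ^ 2)) by ring end.
  apply Rmult_integral_contrapositive. split; [now apply pow_nonzero|exact Hdet].
Qed.

(** * Radial and angular fields of a general rotational surface *)

Lemma is_derive_dilation (phi phi' : R -> R) (k t : R) :
  (forall s, is_derive phi s (phi' s)) -> is_derive (fun s => phi (k * s)) t (k * phi' (k * t)).
Proof.
  intros H. apply (is_derive_comp phi (fun s => k * s)); [apply H|].
  auto_derive; [easy|ring].
Qed.

(** Common description of the two types of surfaces: [eps = 1] for
    [(sinh, cosh)] and [eps = -1] for [(cosh, sinh)]. *)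
Record hyperbolic_pair (eps : R) (sh ch : R -> R) : Prop := {
  hyp_sign : eps ^ 2 = 1;
  hyp_norm : forall t, ch t ^ 2 - sh t ^ 2 = eps;
  hyp_dS : forall t, is_derive sh t (ch t);
  hyp_dC : forall t, is_derive ch t (sh t) }.

Lemma hyperbolic_pair_sinh_cosh : hyperbolic_pair 1 sinh cosh.
Proof.
  split; [ring| | |]; intros t.
  - unfold sinh, cosh.
    assert (H : exp t * exp (- t) = 1) by (rewrite <- exp_plus, Rplus_opp_r; apply exp_0).
    nra.
  - apply is_derive_Reals, derivable_pt_lim_sinh.
  - apply is_derive_Reals, derivable_pt_lim_cosh.
Qed.

Lemma hyperbolic_pair_cosh_sinh : hyperbolic_pair (-1) cosh sinh.
Proof.
  destruct hyperbolic_pair_sinh_cosh as [_ H HS HC].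
  split; [ring| |assumption|assumption]. intros t. specialize (H t). lra.
Qed.

(** With [(p, q) = (f, g)] this is the surface itself; all derivatives of the
    surface and both normal fields are again of the form [radial] or
    [angular]. *)
Definition radial (alpha beta : R) (sh ch : R -> R) (p q : R -> R) : R -> R -> R4 := fun u v =>
  (p u * cos (alpha * v), p u * sin (alpha * v), q u * sh (beta * v), q u * ch (beta * v)).

Definition angular (alpha beta : R) (sh ch : R -> R) (p q : R -> R) : R -> R -> R4 := fun u v =>
  (p u * - sin (alpha * v), p u * cos (alpha * v), q u * ch (beta * v), q u * sh (beta * v)).

Lemma mink_radial alpha beta eps sh ch p q p' q' u v :
  hyperbolic_pair eps sh ch ->
  mink (radial alpha beta sh ch p q u v) (radial alpha beta sh ch p' q' u v) =
  p u * p' u - eps * (q u * q' u).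
Proof.
  intros H. rewrite <- (hyp_norm _ _ _ H (beta * v)). unfold mink, radial, x1, x2, x3, x4; simpl.
  assert (T := sin2_cos2 (alpha * v)). unfold Rsqr in T.
  transitivity (p u * p' u *
      (sin (alpha * v) * sin (alpha * v) + cos (alpha * v) * cos (alpha * v))
    - (ch (beta * v) ^ 2 - sh (beta * v) ^ 2) * (q u * q' u)); [ring|rewrite T; ring].
Qed.

Lemma mink_angular alpha beta eps sh ch p q p' q' u v :
  hyperbolic_pair eps sh ch ->
  mink (angular alpha beta sh ch p q u v) (angular alpha beta sh ch p' q' u v) =
  p u * p' u + eps * (q u * q' u).
Proof.
  intros H. rewrite <- (hyp_norm _ _ _ H (beta * v)). unfold mink, angular, x1, x2, x3, x4; simpl.
  assert (T := sin2_cos2 (alpha * v)). unfold Rsqr in T.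
  transitivity (p u * p' u *
      (sin (alpha * v) * sin (alpha * v) + cos (alpha * v) * cos (alpha * v))
    + (ch (beta * v) ^ 2 - sh (beta * v) ^ 2) * (q u * q' u)); [ring|rewrite T; ring].
Qed.

Lemma mink_radial_angular alpha beta sh ch p q p' q' u v :
  mink (radial alpha beta sh ch p q u v) (angular alpha beta sh ch p' q' u v) = 0.
Proof. unfold mink, radial, angular, x1, x2, x3, x4; simpl. ring. Qed.

Lemma du4_radial alpha beta sh ch p q :
  du4 (radial alpha beta sh ch p q) = radial alpha beta sh ch (Derive p) (Derive q).
Proof.
  extensionality u. extensionality v. unfold du4, du, radial, x1, x2, x3, x4; simpl.
  now rewrite !Derive_scal_l.
Qed.

Lemma dv4_radial alpha beta eps sh ch p q :
  hyperbolic_pair eps sh ch ->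
  dv4 (radial alpha beta sh ch p q) =
  angular alpha beta sh ch (fun u => alpha * p u) (fun u => beta * q u).
Proof.
  intros H. extensionality u. extensionality v. apply dv4_unique.
  unfold is_vderive, radial, angular, x1, x2, x3, x4; cbn [fst snd].
  split; [|split; [|split]].
  - auto_derive; [easy|ring].
  - auto_derive; [easy|ring].
  - evar_last.
    + apply is_derive_scal, is_derive_dilation, (hyp_dS _ _ _ H).
    + simpl. ring.
  - evar_last.
    + apply is_derive_scal, is_derive_dilation, (hyp_dC _ _ _ H).
    + simpl. ring.
Qed.

Lemma dv4_angular alpha beta eps sh ch p q :
  hyperbolic_pair eps sh ch ->
  dv4 (angular alpha beta sh ch p q) =
  radial alpha beta sh ch (fun u => - alpha * p u) (fun u => beta * q u).
Proof.
  intros H. extensionality u. extensionality v. apply dv4_unique.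
  unfold is_vderive, radial, angular, x1, x2, x3, x4; cbn [fst snd].
  split; [|split; [|split]].
  - auto_derive; [easy|ring].
  - auto_derive; [easy|ring].
  - evar_last.
    + apply is_derive_scal, is_derive_dilation, (hyp_dC _ _ _ H).
    + simpl. ring.
  - evar_last.
    + apply is_derive_scal, is_derive_dilation, (hyp_dS _ _ _ H).
    + simpl. ring.
Qed.

Lemma smooth_near_radial_angular alpha beta eps sh ch p q u v : hyperbolic_pair eps sh ch ->
  smooth_at p u -> smooth_at q u ->
  smooth4_near (radial alpha beta sh ch p q) u v /\ smooth4_near (angular alpha beta sh ch p q) u v.
Proof.
  intros H Hp Hq.
  destruct (smooth_at_of_linear_system (fun t => - sin (alpha * t)) (fun t => cos (alpha * t))
    (- alpha) alpha v) as [HmS HCo]; try (intros s; auto_derive; trivial; ring).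
  destruct (smooth_at_of_linear_system (fun t => sh (beta * t)) (fun t => ch (beta * t))
    beta beta v) as [Hsh Hch].
  { intros s. apply is_derive_dilation, (hyp_dS _ _ _ H). }
  { intros s. apply is_derive_dilation, (hyp_dC _ _ _ H). }
  assert (HS : smooth_at (fun t => sin (alpha * t)) v).
  { apply (smooth_at_ext_loc (fun t => -1 * - sin (alpha * t)));
      [apply (filter_forall (F := locally v)); intros t; ring|].
    now apply smooth_at_scal. }
  split; split; [|split; [|split]| |split; [|split]]; now apply smooth_near_product.
Qed.

(** * The normal frame and the second fundamental form *)

(** Up to normalization of [n1], this is [G * c11 n1 - E * c22 n1]: it vanishes
    exactly when the shape operator of [n1] is a multiple of the identity. *)
Definition meridian_defect (eps alpha beta : R) (f g : R -> R) (u : R) : R :=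
  (alpha ^ 2 * f u ^ 2 + eps * beta ^ 2 * g u ^ 2) *
    (Derive (Derive f) u * Derive g u - Derive (Derive g) u * Derive f u) +
  (Derive f u ^ 2 - eps * Derive g u ^ 2) *
    (alpha ^ 2 * f u * Derive g u + beta ^ 2 * g u * Derive f u).

(** The squared length of [radial g' (eps * f')], equal to [- eps * E]. *)
Definition radial_norm2 (eps : R) (f g : R -> R) (u : R) : R :=
  Derive g u * Derive g u + - eps * (Derive f u * Derive f u).

(** The squared length of [angular (beta * g) (- eps * alpha * f)], equal to
    [eps * G]. *)
Definition angular_norm2 (eps alpha beta : R) (f g : R -> R) (u : R) : R :=
  beta * g u * (beta * g u) + eps * (alpha * f u * (alpha * f u)).

(** The two inequalities express, for either sign of [eps], that the surface is
    timelike: [E] has the sign of [- eps] and [G] that of [eps]. *)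
Definition regular_at (eps alpha beta : R) (f g : R -> R) (u : R) : Prop :=
  smooth_at f u /\ smooth_at g u /\
  0 < radial_norm2 eps f g u /\ 0 < angular_norm2 eps alpha beta f g u.

Lemma smooth_at_norm2 eps alpha beta f g u : smooth_at f u -> smooth_at g u ->
  smooth_at (radial_norm2 eps f g) u /\ smooth_at (angular_norm2 eps alpha beta f g) u.
Proof.
  intros Hf Hg.
  assert (Hf' := smooth_at_Derive f u Hf). assert (Hg' := smooth_at_Derive g u Hg).
  split.
  - exact (smooth_at_plus _ _ _ (smooth_at_mult _ _ _ Hg' Hg')
      (smooth_at_scal _ _ _ (smooth_at_mult _ _ _ Hf' Hf'))).
  - assert (Hag := smooth_at_scal beta g u Hg). assert (Haf := smooth_at_scal alpha f u Hf).
    exact (smooth_at_plus _ _ _ (smooth_at_mult _ _ _ Hag Hag)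
      (smooth_at_scal _ _ _ (smooth_at_mult _ _ _ Haf Haf))).
Qed.

Lemma smooth_at_continuous_pos f u : smooth_at f u -> 0 < f u -> locally u (fun t => 0 < f t).
Proof.
  intros Hf H0. apply (smooth_at_continuous f u Hf (fun y => 0 < y)).
  now apply open_gt.
Qed.

Definition normalized (N p : R -> R) (u : R) : R := p u * / sqrt (N u).

Lemma smooth_at_normalized N p u :
  smooth_at N u -> smooth_at p u -> 0 < N u -> smooth_at (normalized N p) u.
Proof.
  intros HN Hp H0. apply smooth_at_mult; [exact Hp|].
  apply (smooth_at_comp Rinv (fun t => sqrt (N t))).
  - apply smooth_at_comp; [exact HN|now apply smooth_at_sqrt].
  - apply smooth_at_Rinv, Rgt_not_eq, sqrt_lt_R0, H0.
Qed.

Definition radial_normal (eps alpha beta : R) (sh ch f g : R -> R) : R -> R -> R4 :=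
  radial alpha beta sh ch (normalized (radial_norm2 eps f g) (Derive g))
    (normalized (radial_norm2 eps f g) (fun t => eps * Derive f t)).

Definition angular_normal (eps alpha beta : R) (sh ch f g : R -> R) : R -> R -> R4 :=
  angular alpha beta sh ch
    (normalized (angular_norm2 eps alpha beta f g) (fun t => beta * g t))
    (normalized (angular_norm2 eps alpha beta f g) (fun t => - eps * (alpha * f t))).

Lemma normalized_square N (x y : R) : 0 < N -> x * / sqrt N * (y * / sqrt N) = x * y / N.
Proof.
  intros HN. assert (H := sqrt_sqrt N (Rlt_le _ _ HN)).
  assert (H0 := sqrt_lt_R0 N HN). rewrite <- H at 3. field. lra.
Qed.

Lemma orthonormal_radial_angular_normal eps alpha beta sh ch f g u v :
  hyperbolic_pair eps sh ch ->
  0 < radial_norm2 eps f g u -> 0 < angular_norm2 eps alpha beta f g u ->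
  orthonormal_normal (radial alpha beta sh ch f g) u v
    (radial_normal eps alpha beta sh ch f g u v) (angular_normal eps alpha beta sh ch f g u v).
Proof.
  intros H HA HB. assert (He := hyp_sign _ _ _ H).
  unfold orthonormal_normal, radial_normal, angular_normal.
  rewrite du4_radial, (dv4_radial _ _ _ _ _ _ _ H).
  rewrite !(mink_radial _ _ _ _ _ _ _ _ _ _ _ H), !(mink_angular _ _ _ _ _ _ _ _ _ _ _ H),
    !mink_radial_angular, (mink_comm (angular _ _ _ _ _ _ _ _)), mink_radial_angular.
  unfold normalized. rewrite !normalized_square by assumption.
  split; [|split; [|split; [|split; [|split; [|split]]]]]; try reflexivity.
  - transitivity (Derive g u * Derive f u * / sqrt (radial_norm2 eps f g u) * (1 - eps ^ 2));
      [ring|rewrite He; ring].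
  - transitivity (beta * alpha * f u * g u *
      / sqrt (angular_norm2 eps alpha beta f g u) * (1 - eps ^ 2));
      [ring|rewrite He; ring].
  - transitivity ((Derive g u * Derive g u - eps * eps ^ 2 * (Derive f u * Derive f u))
      / radial_norm2 eps f g u); [field; lra|]. rewrite He.
    unfold radial_norm2 in *. field. lra.
  - transitivity ((beta * g u * (beta * g u) + eps * eps ^ 2 * (alpha * f u * (alpha * f u)))
      / angular_norm2 eps alpha beta f g u); [field; lra|]. rewrite He.
    unfold angular_norm2 in *. field. lra.
Qed.

Lemma normal_frame_radial_angular_normal eps alpha beta sh ch f g u v :
  hyperbolic_pair eps sh ch -> regular_at eps alpha beta f g u ->
  normal_frame_near (radial alpha beta sh ch f g)
    (radial_normal eps alpha beta sh ch f g) (angular_normal eps alpha beta sh ch f g) u v.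
Proof.
  intros H (Hf & Hg & HA & HB).
  destruct (smooth_at_norm2 eps alpha beta f g u Hf Hg) as [SA SB].
  assert (Hf' := smooth_at_Derive f u Hf). assert (Hg' := smooth_at_Derive g u Hg).
  split; [|split].
  - exact (proj1 (smooth_near_radial_angular alpha beta _ _ _ _ _ u v H
      (smooth_at_normalized _ _ _ SA Hg' HA)
      (smooth_at_normalized _ _ _ SA (smooth_at_scal eps _ _ Hf') HA))).
  - exact (proj2 (smooth_near_radial_angular alpha beta _ _ _ _ _ u v H
      (smooth_at_normalized _ _ _ SB (smooth_at_scal beta _ _ Hg) HB)
      (smooth_at_normalized _ _ _ SB
        (smooth_at_scal (- eps) _ _ (smooth_at_scal alpha _ _ Hf)) HB))).
  - apply (locally_2d_impl (fun s t =>
      (0 < radial_norm2 eps f g s /\ 0 < angular_norm2 eps alpha beta f g s) /\ True)).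
    + apply locally_2d_forall. intros s t [[HAs HBs] _].
      now apply orthonormal_radial_angular_normal.
    + apply locally_2d_product; [|apply (filter_forall (F := locally v)); easy].
      apply filter_and; now apply smooth_at_continuous_pos.
Qed.

(** * Flatness of the normal connection *)

Lemma radial_linear alpha beta sh ch u v n : exists L M, forall p q,
  mink (radial alpha beta sh ch p q u v) n = p u * L + q u * M.
Proof.
  exists (cos (alpha * v) * x1 n + sin (alpha * v) * x2 n),
    (sh (beta * v) * x3 n - ch (beta * v) * x4 n).
  intros p q. unfold mink, radial, x1, x2, x3, x4. cbn [fst snd]. ring.
Qed.

Lemma radial_norm2_eq eps f g u : eps ^ 2 = 1 ->
  radial_norm2 eps f g u = - eps * (Derive f u ^ 2 - eps * Derive g u ^ 2).
Proof.
  intros He. unfold radial_norm2.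
  transitivity (eps ^ 2 * Derive g u ^ 2 - eps * Derive f u ^ 2); [rewrite He|]; ring.
Qed.

Lemma angular_norm2_eq eps alpha beta f g u : eps ^ 2 = 1 ->
  angular_norm2 eps alpha beta f g u = eps * (alpha ^ 2 * f u ^ 2 + eps * beta ^ 2 * g u ^ 2).
Proof.
  intros He. unfold angular_norm2.
  transitivity (eps ^ 2 * beta ^ 2 * g u ^ 2 + eps * (alpha ^ 2 * f u ^ 2)); [rewrite He|]; ring.
Qed.

Lemma fundamental_form eps alpha beta sh ch f g u v :
  hyperbolic_pair eps sh ch ->
  let z := radial alpha beta sh ch f g in
  mink (du4 z u v) (du4 z u v) = Derive f u ^ 2 - eps * Derive g u ^ 2 /\
  mink (du4 z u v) (dv4 z u v) = 0 /\
  mink (dv4 z u v) (dv4 z u v) = alpha ^ 2 * f u ^ 2 + eps * beta ^ 2 * g u ^ 2.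
Proof.
  intros H. cbv zeta. rewrite du4_radial, (dv4_radial _ _ _ _ _ _ _ H),
    (mink_radial _ _ _ _ _ _ _ _ _ _ _ H),
    (mink_angular _ _ _ _ _ _ _ _ _ _ _ H), mink_radial_angular.
  repeat split; ring.
Qed.

Lemma first_form_neq_0 eps alpha beta f g u : eps ^ 2 = 1 -> regular_at eps alpha beta f g u ->
  Derive f u ^ 2 - eps * Derive g u ^ 2 <> 0 /\
   alpha ^ 2 * f u ^ 2 + eps * beta ^ 2 * g u ^ 2 <> 0.
Proof.
  intros He (_ & _ & HA & HB).
  rewrite radial_norm2_eq in HA by assumption. rewrite angular_norm2_eq in HB by assumption.
  split; intros E0; rewrite E0, Rmult_0_r in *; lra.
Qed.

Lemma gram_det_neq_0 eps alpha beta sh ch f g u v :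
  hyperbolic_pair eps sh ch -> regular_at eps alpha beta f g u ->
  gram_det (du4 (radial alpha beta sh ch f g) u v)
    (dv4 (radial alpha beta sh ch f g) u v) <> 0.
Proof.
  intros H Hreg. unfold gram_det.
  destruct (fundamental_form eps alpha beta sh ch f g u v H) as (-> & -> & ->).
  rewrite pow_i, Rminus_0_r by lia.
  apply Rmult_integral_contrapositive. exact (first_form_neq_0 _ _ _ _ _ _ (hyp_sign _ _ _ H) Hreg).
Qed.

(** When the defect vanishes, the radial vector [G * z_uu - E * z_vv] is parallel
    to [z_u].  Hence [G * c11 n = E * c22 n] for every normal [n], and
    [G * Delta1 + E * Delta3] is zero in every normal frame, not only in the
    adapted one. *)
Lemma flat_of_meridian_defect eps alpha beta sh ch f g u v :
  hyperbolic_pair eps sh ch -> regular_at eps alpha beta f g u ->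
  meridian_defect eps alpha beta f g u = 0 ->
  flat_normal_connection_at (radial alpha beta sh ch f g) u v.
Proof.
  intros H Hreg Hd X Y n1 n2 HXY Hn.
  assert (Hz := proj1 (smooth_near_radial_angular alpha beta _ _ _ _ _ u v H
    (proj1 Hreg) (proj1 (proj2 Hreg)))).
  assert (Hgram := gram_det_neq_0 eps alpha beta sh ch f g u v H Hreg).
  rewrite (ricci_equation _ X Y n1 n2 u v Hz Hgram HXY Hn).
  cbv zeta. destruct (fundamental_form eps alpha beta sh ch f g u v H) as (-> & -> & ->).
  set (z := radial alpha beta sh ch f g).
  destruct Hn as (_ & _ & Hon).
  destruct (locally_2d_singleton _ _ _ Hon) as (H1u & H1v & H2u & H2v & _).
  destruct (first_form_neq_0 _ _ _ _ _ _ (hyp_sign _ _ _ H) Hreg) as [HE HG].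
  assert (T : forall n, mink n (du4 z u v) = 0 ->
    (alpha ^ 2 * f u ^ 2 + eps * beta ^ 2 * g u ^ 2) * mink (du4 (du4 z) u v) n =
    (Derive f u ^ 2 - eps * Derive g u ^ 2) * mink (dv4 (dv4 z) u v) n).
  { intros n. rewrite mink_comm. unfold z.
    rewrite (dv4_radial _ _ _ _ _ _ _ H), (dv4_angular _ _ _ _ _ _ _ H), !du4_radial.
    destruct (radial_linear alpha beta sh ch u v n) as (L & M & HLM).
    rewrite !HLM. intros H0. unfold meridian_defect in Hd.
    apply Rminus_diag_uniq, (Rmult_eq_reg_l (Derive f u ^ 2 - eps * Derive g u ^ 2)); [|exact HE].
    set (E := Derive f u ^ 2 - eps * Derive g u ^ 2) in *.
    set (G := alpha ^ 2 * f u ^ 2 + eps * beta ^ 2 * g u ^ 2) in *.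
    set (a := G * Derive (Derive f) u + E * alpha ^ 2 * f u).
    set (b := G * Derive (Derive g) u - E * beta ^ 2 * g u).
    assert (Hab : a * Derive g u = b * Derive f u) by (unfold a, b; lra).
    transitivity (E * (a * L + b * M)); [unfold a, b; ring|].
    (* [(a, b)] is proportional to [(f', g')], which annihilates [(L, M)] *)
    transitivity (
      Derive f u * a * (Derive f u * L + Derive g u * M)
      - Derive f u * (a * Derive g u - b * Derive f u) * M
      - eps * (Derive g u * b * (Derive f u * L + Derive g u * M)
               + Derive g u * (a * Derive g u - b * Derive f u) * L)).
    - unfold E; ring.
    - rewrite H0, Hab. ring. }
  assert (T1 := T _ H1u). assert (T2 := T _ H2u).
  match goal with |- - (?G * (?a * ?b - ?c * ?d) - 0 * _ + ?E * (?c * ?e - ?k * ?b)) / _ = 0 =>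
    replace (- (G * (a * b - c * d) - 0 * (a * e - k * d) + E * (c * e - k * b)))
      with ((E * k - G * a) * b + c * (G * d - E * e)) by ring end.
  rewrite T1, T2. unfold Rdiv. ring.
Qed.

(** The shape operator of [n1] is diagonal, that of [n2] antidiagonal. *)
Lemma second_fundamental_form eps alpha beta sh ch f g u v :
  hyperbolic_pair eps sh ch ->
  0 < radial_norm2 eps f g u -> 0 < angular_norm2 eps alpha beta f g u ->
  let z := radial alpha beta sh ch f g in
  let n1 := radial_normal eps alpha beta sh ch f g in
  let n2 := angular_normal eps alpha beta sh ch f g in
  mink (du4 (du4 z) u v) (n2 u v) = 0 /\ mink (dv4 (du4 z) u v) (n1 u v) = 0 /\
  mink (dv4 (dv4 z) u v) (n2 u v) = 0 /\
  mink (du4 (du4 z) u v) (n1 u v) =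
    (Derive (Derive f) u * Derive g u - Derive (Derive g) u * Derive f u) /
      sqrt (radial_norm2 eps f g u) /\
  mink (dv4 (dv4 z) u v) (n1 u v) =
    - (alpha ^ 2 * f u * Derive g u + beta ^ 2 * g u * Derive f u) /
      sqrt (radial_norm2 eps f g u) /\
  mink (dv4 (du4 z) u v) (n2 u v) =
    alpha * beta * (g u * Derive f u - f u * Derive g u) /
      sqrt (angular_norm2 eps alpha beta f g u).
Proof.
  intros H HA HB. cbv zeta. assert (He := hyp_sign _ _ _ H).
  apply sqrt_lt_R0 in HA, HB.
  unfold radial_normal, angular_normal.
  rewrite (dv4_radial _ _ _ _ _ _ _ H), (dv4_angular _ _ _ _ _ _ _ H), !du4_radial,
    (dv4_radial _ _ _ _ _ _ _ H).
  rewrite !(mink_radial _ _ _ _ _ _ _ _ _ _ _ H), !(mink_angular _ _ _ _ _ _ _ _ _ _ _ H),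
    !mink_radial_angular, (mink_comm (angular _ _ _ _ _ _ _ _)), mink_radial_angular.
  unfold normalized.
  split; [reflexivity|split; [reflexivity|split; [reflexivity|]]].
  split; [|split].
  - transitivity ((Derive (Derive f) u * Derive g u
      - eps ^ 2 * Derive (Derive g) u * Derive f u) / sqrt (radial_norm2 eps f g u)).
    + field. lra.
    + rewrite He. field. lra.
  - transitivity (- (alpha ^ 2 * f u * Derive g u
      + eps ^ 2 * (beta ^ 2 * g u * Derive f u)) / sqrt (radial_norm2 eps f g u)).
    + field. lra.
    + rewrite He. field. lra.
  - transitivity (alpha * beta * (g u * Derive f u - eps ^ 2 * f u * Derive g u) /
      sqrt (angular_norm2 eps alpha beta f g u)).
    + field. lra.
    + rewrite He. field. lra.
Qed.

(** All three determinants are multiples of [c12 n2]. *)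
Lemma transversal_of_inflection_free eps alpha beta sh ch f g u v :
  hyperbolic_pair eps sh ch -> regular_at eps alpha beta f g u ->
  inflection_free_at (radial alpha beta sh ch f g) u v ->
  g u * Derive f u - f u * Derive g u <> 0.
Proof.
  intros H (_ & _ & HA & HB) Hinf H0.
  apply (Hinf (radial_normal eps alpha beta sh ch f g u v)
    (angular_normal eps alpha beta sh ch f g u v));
    [now apply orthonormal_radial_angular_normal|].
  destruct (second_fundamental_form eps alpha beta sh ch f g u v H HA HB)
    as (-> & -> & -> & _ & _ & ->).
  rewrite H0. unfold Rdiv. repeat split; ring.
Qed.

(** For the coordinate frame and the normal frame [(n1, n2)] the curvature is
    the defect times a multiple of [g * f' - f * g']. *)
Lemma meridian_defect_of_flat eps alpha beta sh ch f g u v :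
  hyperbolic_pair eps sh ch -> 0 < alpha -> 0 < beta ->
  regular_at eps alpha beta f g u ->
  inflection_free_at (radial alpha beta sh ch f g) u v ->
  flat_normal_connection_at (radial alpha beta sh ch f g) u v ->
  meridian_defect eps alpha beta f g u = 0.
Proof.
  intros H Ha Hb Hreg Hinf Hflat.
  apply (transversal_of_inflection_free eps) in Hinf; [|exact H|exact Hreg].
  assert (HXY : tangent_frame_near (fun _ _ => 1, fun _ _ => 0) (fun _ _ => 0, fun _ _ => 1) u v).
  { do 2 (split; [exact (smooth_near_const _ u v)|]).
    do 2 (split; [exact (smooth_near_const _ u v)|]).
    apply locally_2d_forall. intros s t. simpl. lra. }
  assert (Hn := normal_frame_radial_angular_normal eps alpha beta sh ch f g u v H Hreg).
  specialize (Hflat _ _ _ _ HXY Hn).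
  assert (Hz := proj1 (smooth_near_radial_angular alpha beta _ _ _ _ _ u v H
    (proj1 Hreg) (proj1 (proj2 Hreg)))).
  assert (Hgram := gram_det_neq_0 eps alpha beta sh ch f g u v H Hreg).
  rewrite (ricci_equation _ _ _ _ _ u v Hz Hgram HXY Hn) in Hflat.
  cbv zeta in Hflat. destruct Hreg as (_ & _ & HA & HB).
  destruct (fundamental_form eps alpha beta sh ch f g u v H) as (EE & EF & EG).
  destruct (second_fundamental_form eps alpha beta sh ch f g u v H HA HB)
    as (E1 & E2 & E3 & E4 & E5 & E6).
  rewrite EE, EF, EG, E1, E2, E3, E4, E5, E6 in Hflat.
  apply sqrt_lt_R0 in HA, HB.
  cbn [fst snd] in Hflat.
  set (det := gram_det _ _) in *.
  match type of Hflat with ?l = 0 =>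
    replace l with (meridian_defect eps alpha beta f g u *
      - (alpha * beta * (g u * Derive f u - f u * Derive g u) /
         (sqrt (radial_norm2 eps f g u) * sqrt (angular_norm2 eps alpha beta f g u) *
          det ^ 2))) in Hflat end.
  - apply Rmult_integral in Hflat. destruct Hflat as [Hflat|Hflat]; [exact Hflat|].
    exfalso. revert Hflat. apply Ropp_neq_0_compat.
    apply Rmult_integral_contrapositive; split.
    + repeat (apply Rmult_integral_contrapositive; split); lra.
    + apply Rinv_neq_0_compat. repeat (apply Rmult_integral_contrapositive; split);
        try lra; apply pow_nonzero; exact Hgram.
  - unfold meridian_defect. field. repeat split; try lra; assumption.
Qed.

Lemma flat_iff_meridian_defect eps alpha beta sh ch J f g :
  hyperbolic_pair eps sh ch -> 0 < alpha -> 0 < beta ->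
  (forall u, J u -> regular_at eps alpha beta f g u) ->
  inflection_free J (radial alpha beta sh ch f g) ->
  (flat_normal_connection J (radial alpha beta sh ch f g) <->
   forall u, J u -> meridian_defect eps alpha beta f g u = 0).
Proof.
  intros H Ha Hb Hreg Hinf. split.
  - intros Hflat u Hu.
    assert (H0 : 0 <= 0 < 2 * PI) by (assert (HPI := PI_RGT_0); lra).
    exact (meridian_defect_of_flat eps alpha beta sh ch f g u 0 H Ha Hb (Hreg u Hu)
      (Hinf u 0 Hu H0) (Hflat u 0 Hu H0)).
  - intros Hd u v Hu _.
    exact (flat_of_meridian_defect eps alpha beta sh ch f g u v H (Hreg u Hu) (Hd u Hu)).
Qed.

(** * Meridians as graphs *)

Lemma meridian_defect_graph eps alpha beta h s :
  meridian_defect eps alpha beta h (fun t => t) s =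
  (alpha ^ 2 * h s ^ 2 + eps * beta ^ 2 * s ^ 2) * Derive (Derive h) s +
  (Derive h s ^ 2 - eps) * (alpha ^ 2 * h s + beta ^ 2 * s * Derive h s).
Proof.
  unfold meridian_defect. rewrite Derive_id.
  rewrite (Derive_ext (Derive (fun t => t)) (fun _ => 1)) by (intros t; apply Derive_id).
  rewrite Derive_const. ring.
Qed.

(** The factor is [g' ^ 3] because both terms of the defect are of third order
    in [d/du]. *)
Lemma meridian_defect_reparam eps alpha beta (J : R -> Prop) f g h :
  is_interval J -> smooth_on J f -> smooth_on J g ->
  (forall u, J u -> smooth_at h (g u)) -> (forall u, J u -> f u = h (g u)) ->
  forall u, J u -> meridian_defect eps alpha beta f g u =
    Derive g u ^ 3 * meridian_defect eps alpha beta h (fun t => t) (g u).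
Proof.
  intros HJ Hf Hg Hh Heq u Hu. rewrite meridian_defect_graph. unfold meridian_defect.
  destruct (chain_rule_on_interval J f g h HJ Hf Hg Hh Heq u Hu) as [E1 E2].
  rewrite E1, E2, (Heq u Hu). ring.
Qed.

Lemma is_derive_ln_ratio (p : R -> R) s p' : is_derive p s p' -> p s ^ 2 < 1 ->
  is_derive (fun t => ln (Rabs ((1 + p t) / (1 - p t)))) s (2 * p' / (1 - p s ^ 2)).
Proof.
  intros Hp H1.
  assert (Hpos : forall x, x ^ 2 < 1 -> 0 < (1 + x) / (1 - x)).
  { intros x Hx. apply Rdiv_lt_0_compat; nra. }
  assert (Hloc : locally s (fun t => 0 < (1 + p t) / (1 - p t))).
  { assert (Hc := ex_derive_continuous p s (ex_intro _ _ Hp)).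
    apply (Hc (fun x => 0 < (1 + x) / (1 - x))).
    assert (Hsq : continuous (fun x => x ^ 2) (p s)).
    { apply (ex_derive_continuous (fun x => x ^ 2)). auto_derive. trivial. }
    apply (filter_imp (F := locally (p s)) (fun x => x ^ 2 < 1)); [exact Hpos|].
    exact (Hsq (fun y => y < 1) (open_lt 1 _ H1)). }
  apply (is_derive_ext_loc (fun t => ln ((1 + p t) / (1 - p t)))).
  - revert Hloc. apply filter_imp. intros t Ht. rewrite Rabs_pos_eq; [reflexivity|lra].
  - assert (Hs := Hpos _ H1). assert (Hne : 1 - p s <> 0 /\ 1 + p s <> 0) by (split; nra).
    evar_last.
    + apply (is_derive_comp ln (fun t => (1 + p t) / (1 - p t))); [now apply is_derive_ln|].
      apply (is_derive_div (fun t => 1 + p t) (fun t => 1 - p t)); [| |tauto].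
      * apply (is_derive_plus (V := R_NormedModule)); [apply is_derive_const|exact Hp].
      * apply (is_derive_minus (V := R_NormedModule)); [apply is_derive_const|exact Hp].
    + unfold scal, plus, minus, plus, opp, zero; simpl; unfold mult; simpl.
      field. repeat split; try tauto. nra.
Qed.

Lemma is_derive_iff_eq (phi : R -> R) s a b : is_derive phi s a -> (is_derive phi s b <-> a = b).
Proof.
  intros Ha. split; [|now intros <-].
  intros Hb. rewrite <- (is_derive_unique _ _ _ Ha). exact (is_derive_unique _ _ _ Hb).
Qed.

Lemma frac_eq_iff (a b c d : R) : b <> 0 -> d <> 0 -> (a / b = c / d <-> a * d = c * b).
Proof.
  intros Hb Hd. split; intros E.
  - apply (Rmult_eq_reg_r (/ b * / d)).
    + transitivity (a / b); [field; tauto|]. rewrite E. field. tauto.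
    + apply Rmult_integral_contrapositive. split; now apply Rinv_neq_0_compat.
  - apply (Rmult_eq_reg_r (b * d)).
    + transitivity (a * d); [field; tauto|]. rewrite E. field. tauto.
    + apply Rmult_integral_contrapositive. tauto.
Qed.

(** The condition [h' ^ 2 < 1] ensures that the argument of the logarithm is
    positive, and its derivative is then [2 * h'' / (1 - h' ^ 2)]. *)
Lemma ode1_at_iff alpha beta h s :
  smooth_at h s -> Derive h s ^ 2 < 1 -> alpha ^ 2 * h s ^ 2 + beta ^ 2 * s ^ 2 > 0 ->
  (is_derive (fun t => ln (Rabs ((1 + Derive h t) / (1 - Derive h t)))) s
     (2 * (alpha ^ 2 * h s + beta ^ 2 * s * Derive h s) /
      (alpha ^ 2 * h s ^ 2 + beta ^ 2 * s ^ 2)) <->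
   meridian_defect 1 alpha beta h (fun t => t) s = 0).
Proof.
  intros Hh H1 HG. rewrite meridian_defect_graph.
  assert (Hd := Derive_correct _ _ (smooth_at_ex_derive _ _ (smooth_at_Derive h s Hh))).
  rewrite (is_derive_iff_eq _ _ _ _ (is_derive_ln_ratio _ _ _ Hd H1)), frac_eq_iff by lra.
  split; intros E; lra.
Qed.

Lemma ode2_at_iff alpha beta h s :
  smooth_at h s -> alpha ^ 2 * h s ^ 2 - beta ^ 2 * s ^ 2 < 0 ->
  (is_derive (fun t => atan (Derive h t)) s
     ((alpha ^ 2 * h s + beta ^ 2 * s * Derive h s) /
      (beta ^ 2 * s ^ 2 - alpha ^ 2 * h s ^ 2)) <->
   meridian_defect (-1) alpha beta h (fun t => t) s = 0).
Proof.
  intros Hh HG. rewrite meridian_defect_graph.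
  assert (Hd := Derive_correct _ _ (smooth_at_ex_derive _ _ (smooth_at_Derive h s Hh))).
  assert (Ha : is_derive (fun t => atan (Derive h t)) s
                 (Derive (Derive h) s / (1 + Derive h s ^ 2))).
  { evar_last; [apply (is_derive_comp atan); [apply is_derive_atan|exact Hd]|].
    unfold scal; simpl; unfold mult, Rsqr, Rdiv; simpl. now rewrite Rmult_1_r. }
  rewrite (is_derive_iff_eq _ _ _ _ Ha), frac_eq_iff by nra.
  split; intros E; lra.
Qed.

Lemma timelike1_regular alpha beta J f g : smooth_on J f -> smooth_on J g ->
  timelike1 alpha beta J f g -> forall u, J u -> regular_at 1 alpha beta f g u.
Proof.
  intros Hf Hg Ht u Hu. destruct (Ht u Hu) as [H1 H2].
  split; [exact (Hf u Hu)|split; [exact (Hg u Hu)|]].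
  unfold radial_norm2, angular_norm2. split; lra.
Qed.

Lemma timelike2_regular alpha beta J f g : smooth_on J f -> smooth_on J g ->
  timelike2 alpha beta J f g -> forall u, J u -> regular_at (-1) alpha beta f g u.
Proof.
  intros Hf Hg Ht u Hu. destruct (Ht u Hu) as [H1 H2].
  split; [exact (Hf u Hu)|split; [exact (Hg u Hu)|]].
  unfold radial_norm2, angular_norm2. split; lra.
Qed.

(** On [J] a reparametrization [psi] onto a graph [(h(s), s)] coincides with
    [g], which is why the existentials over [psi] and the interval disappear. *)
Lemma determined_iff_meridian_defect eps alpha beta (J : R -> Prop) (f g : R -> R)
  (meridian : (R -> R) -> (R -> R) -> R -> R4) (ode_at : (R -> R) -> R -> Prop) :
  is_interval J -> smooth_on J f -> smooth_on J g -> (forall u, J u -> Derive g u <> 0) ->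
  (forall p q p' q' s t, meridian p q s = meridian p' q' t <-> p s = p' t /\ q s = q' t) ->
  (forall h u, J u -> smooth_at h (g u) -> f u = h (g u) ->
     Derive f u = Derive h (g u) * Derive g u ->
     (ode_at h (g u) <-> meridian_defect eps alpha beta h (fun t => t) (g u) = 0)) ->
  ((exists (I : R -> Prop) (h : R -> R),
      is_interval I /\ smooth_on I h /\
      reparam J (meridian f g) I (meridian h (fun t => t)) /\
      forall s, I s -> ode_at h s) <->
   forall u, J u -> meridian_defect eps alpha beta f g u = 0).
Proof.
  intros HJ Hf Hg Hg' Hmer Hode.
  assert (Hode' : forall h,
    (forall u, J u -> smooth_at h (g u)) -> (forall u, J u -> f u = h (g u)) ->
    forall u, J u -> (ode_at h (g u) <-> meridian_defect eps alpha beta f g u = 0)).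
  { intros h Hh Hfh u Hu.
    rewrite (meridian_defect_reparam eps alpha beta J f g h HJ Hf Hg Hh Hfh u Hu).
    rewrite (Hode h u Hu (Hh u Hu) (Hfh u Hu)
      (proj1 (chain_rule_on_interval J f g h HJ Hf Hg Hh Hfh u Hu))).
    split; [intros ->; apply Rmult_0_r|].
    intros E. apply Rmult_integral in E. destruct E as [E|E]; [|exact E].
    exfalso. exact (pow_nonzero _ _ (Hg' u Hu) E). }
  split.
  - intros (I & h & _ & Hh & (psi & _ & _ & HI & Heq) & Hs) u Hu.
    assert (Hpsi : forall t, J t -> I (g t) /\ f t = h (g t)).
    { intros t Ht. destruct (proj1 (Hmer _ _ _ _ _ _) (Heq t Ht)) as [Ef Eg].
      rewrite Eg. split; [apply HI; now exists t|exact Ef]. }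
    apply (Hode' h); [|intros t Ht; exact (proj2 (Hpsi t Ht))|exact Hu|].
    + intros t Ht. exact (Hh _ (proj1 (Hpsi t Ht))).
    + exact (Hs _ (proj1 (Hpsi u Hu))).
  - intros Hd. destruct (graph_over_image J f g HJ Hf Hg Hg') as (h & Hh & Hfh).
    exists (image J g), h. split; [now apply is_interval_image|split; [exact Hh|split]].
    + exists g. split; [exact Hg|split; [exact Hg'|split; [reflexivity|]]].
      intros u Hu. apply Hmer. split; [exact (Hfh u Hu)|reflexivity].
    + intros s (u & Hu & <-). apply (Hode' h); [|exact Hfh|exact Hu|exact (Hd u Hu)].
      intros t Ht. apply (Hh (g t)). now exists t.
Qed.

Lemma determined1_iff alpha beta J f g : is_interval J -> smooth_on J f -> smooth_on J g ->
  timelike1 alpha beta J f g ->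
  (determined1 alpha beta J f g <-> forall u, J u -> meridian_defect 1 alpha beta f g u = 0).
Proof.
  intros HJ Hf Hg Ht.
  assert (Hg' : forall u, J u -> Derive g u <> 0).
  { intros u Hu E. destruct (Ht u Hu) as [H1 _]. rewrite E in H1. nra. }
  apply (determined_iff_meridian_defect 1 alpha beta J f g meridian1
    (fun h s => is_derive (fun t => ln (Rabs ((1 + Derive h t) / (1 - Derive h t)))) s
       (2 * (alpha ^ 2 * h s + beta ^ 2 * s * Derive h s) /
        (alpha ^ 2 * h s ^ 2 + beta ^ 2 * s ^ 2)))); try assumption.
  - intros p q p' q' s t. unfold meridian1.
    split; [intros E; injection E; auto|intros [-> ->]; reflexivity].
  - intros h u Hu Hh Efh Edf. destruct (Ht u Hu) as [H1 H2].
    rewrite Edf in H1. rewrite Efh in H2. apply ode1_at_iff; try assumption.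
    assert (H0 := pow2_gt_0 _ (Hg' u Hu)). apply (Rmult_lt_reg_r (Derive g u ^ 2)); lra.
Qed.

Lemma determined2_iff alpha beta J f g : is_interval J -> smooth_on J f -> smooth_on J g ->
  timelike2 alpha beta J f g -> (forall u, J u -> Derive g u <> 0) ->
  (determined2 alpha beta J f g <-> forall u, J u -> meridian_defect (-1) alpha beta f g u = 0).
Proof.
  intros HJ Hf Hg Ht Hg'.
  apply (determined_iff_meridian_defect (-1) alpha beta J f g meridian2
    (fun h s => is_derive (fun t => atan (Derive h t)) s
       ((alpha ^ 2 * h s + beta ^ 2 * s * Derive h s) /
        (beta ^ 2 * s ^ 2 - alpha ^ 2 * h s ^ 2)))); try assumption.
  - intros p q p' q' s t. unfold meridian2.
    split; [intros E; injection E; auto|intros [-> ->]; reflexivity].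
  - intros h u Hu Hh Efh _. destruct (Ht u Hu) as [H1 _]. rewrite Efh in H1.
    now apply ode2_at_iff.
Qed.

(** * Second type: zeros of [g'] *)

(** Where [g'] vanishes identically the defect is [beta ^ 2 * g * f' ^ 3], and
    both [g] and [f'] are nonzero on a timelike surface of second type. *)
Lemma timelike2_meridian_not_vertical alpha beta (K : R -> Prop) f g : 0 < beta ->
  is_interval K -> smooth_on K g -> timelike2 alpha beta K f g ->
  (forall u, K u -> meridian_defect (-1) alpha beta f g u = 0) ->
  exists u, K u /\ Derive g u <> 0.
Proof.
  intros Hb HK Hg Ht Hd. apply NNPP. intros Hno.
  assert (H0 : forall t, K t -> Derive g t = 0).
  { intros t HKt. apply NNPP. intros Hne. apply Hno. now exists t. }
  destruct HK as [(u & b & Hu & Hb' & Hub) Hconv].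
  assert (HK : is_interval K) by (split; [now exists u, b|exact Hconv]).
  specialize (Hd u Hu). destruct (Ht u Hu) as [H1 H2]. unfold meridian_defect in Hd.
  rewrite (Derive_eq_on_interval K (Derive g) (fun _ => 0) u HK H0 Hu), Derive_const,
    (H0 u Hu) in Hd.
  - rewrite (H0 u Hu) in H2.
    assert (Hf' : Derive f u <> 0) by (intros E; rewrite E in H2; lra).
    assert (Hgu : g u <> 0) by (intros E; rewrite E in H1; nra).
    assert (E : beta ^ 2 * (g u * Derive f u ^ 3) = 0) by lra.
    revert E. apply Rmult_integral_contrapositive. split; [apply pow_nonzero; lra|].
    apply Rmult_integral_contrapositive. split; [exact Hgu|now apply pow_nonzero].
  - exact (smooth_at_ex_derive _ _ (smooth_at_Derive _ _ (Hg u Hu))).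
  - apply ex_derive_const.
Qed.

Lemma smooth_at_meridian_defect eps alpha beta f g u : smooth_at f u -> smooth_at g u ->
  smooth_at (meridian_defect eps alpha beta f g) u.
Proof.
  intros Hf Hg.
  assert (Hf1 := smooth_at_Derive _ _ Hf). assert (Hg1 := smooth_at_Derive _ _ Hg).
  assert (Hf2 := smooth_at_Derive _ _ Hf1). assert (Hg2 := smooth_at_Derive _ _ Hg1).
  set (sq := fun (p : R -> R) (t : R) => p t * p t).
  assert (Hsq : forall p, smooth_at p u -> smooth_at (sq p) u)
    by (intros p Hp; exact (smooth_at_mult _ _ _ Hp Hp)).
  assert (HE := smooth_at_plus _ _ _ (Hsq _ Hf1) (smooth_at_scal (- eps) _ _ (Hsq _ Hg1))).
  assert (HG := smooth_at_plus _ _ _ (smooth_at_scal (alpha ^ 2) _ _ (Hsq _ Hf))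
                  (smooth_at_scal (eps * beta ^ 2) _ _ (Hsq _ Hg))).
  assert (HL := smooth_at_plus _ _ _ (smooth_at_mult _ _ _ Hf2 Hg1)
                  (smooth_at_scal (-1) _ _ (smooth_at_mult _ _ _ Hg2 Hf1))).
  assert (HM := smooth_at_plus _ _ _ (smooth_at_scal (alpha ^ 2) _ _ (smooth_at_mult _ _ _ Hf Hg1))
                  (smooth_at_scal (beta ^ 2) _ _ (smooth_at_mult _ _ _ Hg Hf1))).
  refine (smooth_at_ext_loc _ _ _ _
    (smooth_at_plus _ _ _ (smooth_at_mult _ _ _ HG HL) (smooth_at_mult _ _ _ HE HM))).
  apply (filter_forall (F := locally u)). intros t. unfold meridian_defect, sq. ring.
Qed.

Lemma eq_0_of_nearby_zeros (F : R -> R) u : continuous F u ->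
  (forall d, 0 < d -> exists w, Rabs (w - u) < d /\ F w = 0) -> F u = 0.
Proof.
  intros Hc Hz. apply NNPP. intros Hne.
  destruct (Hc (fun y => y <> 0) (open_neq 0 _ Hne)) as [d Hd].
  destruct (Hz d (cond_pos d)) as (w & Hw & E). exact (Hd w Hw E).
Qed.

Lemma interval_cap_ball (J : R -> Prop) u d : is_interval J -> J u -> 0 < d ->
  is_interval (fun t => J t /\ Rabs (t - u) < d).
Proof.
  intros HJ Hu Hd. split.
  - destruct (interval_has_nearby_point J u d HJ Hu Hd) as (w & Hw & Hne & Hwd).
    assert (Huu : Rabs (u - u) < d) by (rewrite Rminus_diag, Rabs_R0; exact Hd).
    destruct (Rlt_le_dec u w).
    + exists u, w. tauto.
    + exists w, u. repeat split; try assumption. lra.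
  - intros a b t [Ha Ha'] [Hb Hb'] Ht. split; [now apply (proj2 HJ a b)|].
    apply Rabs_def2 in Ha', Hb'. apply Rabs_def1; lra.
Qed.

(** Every neighbourhood of [u] contains a point [w] with [g' w <> 0], around
    which the meridian is a graph; the defect vanishes at [w], hence at [u] by
    continuity. *)
Lemma meridian_defect_of_piecewise_determined2 alpha beta J f g :
  is_interval J -> smooth_on J f -> smooth_on J g -> timelike2 alpha beta J f g ->
  piecewise_determined2 alpha beta J f g ->
  forall u, J u -> meridian_defect (-1) alpha beta f g u = 0.
Proof.
  intros HJ Hf Hg Ht Hpw u Hu.
  apply eq_0_of_nearby_zeros.
  { apply smooth_at_continuous, smooth_at_meridian_defect; [exact (Hf u Hu)|exact (Hg u Hu)]. }
  intros d Hd.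
  destruct (Hpw _ (interval_cap_ball J u d HJ Hu Hd)) as [(w & [Hw Hwd] & Hgw) _]; [tauto|].
  exists w. split; [exact Hwd|].
  destruct (smooth_at_continuous _ _ (smooth_at_Derive g w (Hg w Hw)) _ (open_neq 0 _ Hgw))
    as [e He].
  set (K := fun t => J t /\ Rabs (t - w) < e).
  assert (HK : is_interval K) by (apply interval_cap_ball; [exact HJ|exact Hw|apply cond_pos]).
  assert (HKJ : forall t, K t -> J t) by (intros t; unfold K; tauto).
  assert (HKg : forall t, K t -> Derive g t <> 0) by (intros t [_ Htw]; exact (He t Htw)).
  apply (determined2_iff alpha beta K f g HK).
  - intros t HKt. exact (Hf t (HKJ t HKt)).
  - intros t HKt. exact (Hg t (HKJ t HKt)).
  - intros t HKt. exact (Ht t (HKJ t HKt)).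
  - exact HKg.
  - exact (proj2 (Hpw K HK HKJ) HKg).
  - split; [exact Hw|]. rewrite Rminus_diag, Rabs_R0. apply cond_pos.
Qed.

Theorem theorem5p1 (J : R -> Prop) (f g : R -> R) (alpha beta : R)
  (hJ : is_interval J) (hf : smooth_on J f) (hg : smooth_on J g)
  (halpha : 0 < alpha) (hbeta : 0 < beta) :
  (timelike1 alpha beta J f g ->
   inflection_free J (surface1 alpha beta f g) ->
   (flat_normal_connection J (surface1 alpha beta f g) <->
    determined1 alpha beta J f g)) /\
  (timelike2 alpha beta J f g ->
   inflection_free J (surface2 alpha beta f g) ->
   ((forall u, J u -> Derive g u <> 0) ->
    (flat_normal_connection J (surface2 alpha beta f g) <->
     determined2 alpha beta J f g)) /\
   (flat_normal_connection J (surface2 alpha beta f g) <->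
    piecewise_determined2 alpha beta J f g)).
Proof.
  split; intros Ht Hinf.
  - rewrite determined1_iff by assumption.
    exact (flat_iff_meridian_defect 1 alpha beta sinh cosh J f g hyperbolic_pair_sinh_cosh
      halpha hbeta (timelike1_regular alpha beta J f g hf hg Ht) Hinf).
  - assert (Hflat := flat_iff_meridian_defect (-1) alpha beta cosh sinh J f g
      hyperbolic_pair_cosh_sinh halpha hbeta (timelike2_regular alpha beta J f g hf hg Ht) Hinf).
    change (radial alpha beta cosh sinh f g) with (surface2 alpha beta f g) in Hflat.
    split.
    + intros Hg'. rewrite Hflat. symmetry. now apply determined2_iff.
    + rewrite Hflat. split; [|now apply meridian_defect_of_piecewise_determined2].
      intros Hd K HK HKJ.
      assert (HfK : smooth_on K f) by (intros u Hu; exact (hf u (HKJ u Hu))).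
      assert (HgK : smooth_on K g) by (intros u Hu; exact (hg u (HKJ u Hu))).
      assert (HtK : timelike2 alpha beta K f g) by (intros u Hu; exact (Ht u (HKJ u Hu))).
      assert (HdK : forall u, K u -> meridian_defect (-1) alpha beta f g u = 0) by auto.
      split; [now apply (timelike2_meridian_not_vertical alpha beta K f g)|].
      intros Hg'. now apply determined2_iff.
Qed.
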